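(* Let $C_3$ be the cyclic group of order $3$ with chosen generator $g$. There is an isomorphism of operads in $C_3$-sets $\mathbb F\{e,\otimes,\boxtimes\}/\langle R\rangle\cong Q_{C_3}$, where $\mathbb F\{e,\otimes,\boxtimes\}$ is the free operad in $C_3$-sets on symbols $e$ of arity $0$, $\otimes$ of arity $2$ and $\boxtimes$ of arity $3$, and $R$ consists of the following relations: 1. (Reduction to identity) $\gamma(\boxtimes;\mathbb 1,e,e)=\gamma(\boxtimes;e,\mathbb 1,e)=\gamma(\boxtimes;e,e,\mathbb 1)=\gamma(\otimes;\mathbb 1,e)=\gamma(\otimes;e,\mathbb 1)=\mathbb 1$; 2. (Strict associativity) for each $\diamondsuit\in\{\otimes,\ \gamma(\boxtimes;e,\mathbb 1,\mathbb 1),\ \gamma(\boxtimes;\mathbb 1,e,\mathbb 1),\ \gamma(\boxtimes;\mathbb 1,\mathbb 1,e)\}$ (representing the primitive elements of $Q_{C_3}(2)$), $\gamma(\diamondsuit;\diamondsuit,\mathbb 1)=\gamma(\diamondsuit;\mathbb 1,\diamondsuit)$; 3. (Group action) $g\cdot\boxtimes=\boxtimes\cdot(1\ 2\ 3)$, $g\cdot\otimes=\otimes$, and $g\cdot e=e$.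
   Context: **Permutations.** $\Sigma_n$ is the symmetric group on $\{1,\dots,n\}$, with product $\sigma\tau$ meaning ''first $\tau$, then $\sigma$''; $(1\ 2\ 3)$ denotes the cycle $1\mapsto2\mapsto3\mapsto1$. For $\sigma\in\Sigma_n$ and $k_1,\dots,k_n\ge 0$ with $k=k_1+\dots+k_n$, split $\{1,\dots,k\}$ into $n$ consecutive (possibly empty) blocks of sizes $k_1,\dots,k_n$. The block permutation $\sigma\langle k_1,\dots,k_n\rangle\in\Sigma_k$ permutes the blocks according to $\sigma$: it sends the $i$-th element of the $j$-th block to $i+\sum_{l:\sigma(l)<\sigma(j)}k_l$. For $\tau_j\in\Sigma_{k_j}$, the block sum $\tau_1\oplus\dots\oplus\tau_n\in\Sigma_k$ permutes by $\tau_j$ within the $j$-th block. Put $\sigma\langle\tau_1,\dots,\tau_n\rangle=\sigma\langle k_1,\dots,k_n\rangle\cdot(\tau_1\oplus\dots\oplus\tau_n)$. **The operad $P_G$.** For a finite group $G$, $P_G$ is the (symmetric) operad in $G$-sets with $P_G(n)$ the set of all functions $f\colon G\to\Sigma_n$ (not necessarily homomorphisms), for $n\ge 0$. The left $G$-action is $(g\cdot f)(h)=f(hg)$, the right $\Sigma_n$-action is $(f\cdot\sigma)(h)=f(h)\sigma$, the composition is $\gamma(f;f_1,\dots,f_n)(h)=f(h)\langle f_1(h),\dots,f_n(h)\rangle$, and the operadic identity is the unique element $\mathbb 1\in P_G(1)$. An element $f\in P_G(n)$ is *primitive* if $f(1_G)=1_{\Sigma_n}$. **$Q_{C_3}$.**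 $Q_{C_3}\subseteq P_{C_3}$ is the smallest suboperad (levelwise subsets closed under the $C_3$- and $\Sigma_n$-actions, containing $\mathbb 1$, and closed under $\gamma$) containing the three elements: $e\in P_{C_3}(0)$, the unique element; $\otimes\in P_{C_3}(2)$, the constant function at $1_{\Sigma_2}$; and $\boxtimes\in P_{C_3}(3)$, with $\boxtimes(1_{C_3})=1_{\Sigma_3}$, $\boxtimes(g)=(1\ 2\ 3)$, $\boxtimes(g^2)=(1\ 3\ 2)$. **Free operads and quotients.** The free operad $\mathbb F S$ in $G$-sets on a sequence of sets $S=\{S_n\}_{n\ge0}$ is the operad in $G$-sets such that operad maps (levelwise $G$- and $\Sigma_n$-equivariant maps preserving identity and composition) $\mathbb F S\to\mathcal O$ correspond to families of functions $S_n\to\mathcal O(n)$; concretely its elements are isomorphism classes of finite rooted planar trees with $k$-ary nodes labeled by $G\times S_k$, together with a permutation of the leaves. A *congruence relation* on an operad $\mathcal O$ in $G$-sets is a family of equivalence relations $\sim_n$ on $\mathcal O(n)$, $n\ge 0$, respecting the $G$- and $\Sigma_n$-actions and operadic composition. For a graded binary relation $R$ on $\mathcal O$, $\langle R\rangle$ is the smallest congruence relation containing $R$, and $\mathcal O/\langle R\rangle$ is the quotient operad. A relation written as an equation $x=y$ means that the pair $(x,y)$ is in $R$. *)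

(* Defs.v *)
From HB Require Import structures.
From mathcomp Require Import all_boot all_order all_fingroup all_solvable.
From mathcomp Require Import boolp.

Set Implicit Arguments.
Unset Strict Implicit.
Unset Printing Implicit Defensive.

Local Open Scope quotient_scope.

Local Notation Rank := (@tagnat.Rank _ _ _).

(* Transport along an equality of arities.  Arities of composites such as
   [\sum_(i < n) k i] are only provably equal to the expected number, so every
   operad law relating two arities goes through [castn]. *)
Definition castn (T : nat -> Type) m n (e : m = n) (x : T m) : T n :=
  eq_rect m T x n e.

Section Cast.
Variable T : nat -> Type.

Lemma castn_id n (e : n = n) (x : T n) : castn e x = x.
Proof. by rewrite (eq_irrelevance e (erefl n)). Qed.

Lemma tag_castn m n (e : m = n) (x : T m) :
  Tagged T (castn e x) = Tagged T x.
Proof. by case: n / e. Qed.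

Lemma tagI n (x y : T n) : Tagged T x = Tagged T y -> x = y.
Proof.
move=> E.
suff H (u v : {n & T n}) (e : tag u = tag v) :
    u = v -> castn e (tagged u) = tagged v.
  exact: (H (Tagged T x) (Tagged T y) (erefl n) E).
by move=> uv; case: v / uv e => e; rewrite castn_id.
Qed.

Lemma castn_tag m n (e : m = n) (x : T m) (y : T n) :
  Tagged T x = Tagged T y -> castn e x = y.
Proof. by move=> E; apply: tagI; rewrite tag_castn. Qed.

Lemma tag_eq_cast m n (e : m = n) (x : T m) (y : T n) :
  castn e x = y -> Tagged T x = Tagged T y.
Proof. by move<-; rewrite tag_castn. Qed.
End Cast.

Arguments tagI {T n x y}.
Arguments castn {T m n}.
Arguments castn_id {T n}.
Arguments tag_castn {T m n}.
Arguments castn_tag {T m n} e {x y}.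
Arguments tag_eq_cast {T m n} e {x y}.

(* A dependent operation respects equality up to arity. *)
Lemma tag_dep (T U V : nat -> Type) (s : forall n, ('I_n -> nat) -> nat)
    (f : forall n (k : 'I_n -> nat), T n -> (forall i, U (k i)) -> V (s n k))
    n n' (x : T n) (x' : T n') (k : 'I_n -> nat) (k' : 'I_n' -> nat)
    (y : forall i, U (k i)) (y' : forall i, U (k' i)) (e : n = n') :
  Tagged T x = Tagged T x' ->
  (forall i, Tagged U (y i) = Tagged U (y' (cast_ord e i))) ->
  Tagged V (f n k x y) = Tagged V (f n' k' x' y').
Proof.
case: n' / e x' k' y' => x' k' y' /tagI <- Ey.
have Ek : k = k'.
  by apply: funext => i; have /(congr1 tag)/= := Ey i; rewrite cast_ord_id.
case: k' / Ek y' Ey => y' Ey.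
congr (Tagged V (f n k x _)).
apply: functional_extensionality_dep => i; apply: tagI.
by rewrite Ey cast_ord_id.
Qed.

Section BlockSums.
Variables (n : nat) (k : 'I_n -> nat).
Implicit Types (P : pred 'I_(\sum_i k i)) (K : 'I_(\sum_i k i) -> nat).

Lemma RankP (p : 'I_(\sum_i k i)) : {i & {j : 'I_(k i) | p = Rank j}}.
Proof. by exists (tagnat.sig1 p), (tagnat.sig2 p); rewrite tagnat.sig2K. Qed.

Lemma sum_Rank_cond P K :
  \sum_(p | P p) K p =
  \sum_i \sum_(j | P (@tagnat.Rank n k i j)) K (Rank j).
Proof.
rewrite (sig_big_dep xpredT (fun i j => P (@tagnat.Rank n k i j))) /=.
rewrite (reindex (@tagnat.rank n k)) /=; last exact/onW_bij/tagnat.rank_bij.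
by apply: eq_big => [q|q _]; rewrite tagnat.rankE.
Qed.

Lemma sum_Rank K :
  \sum_p K p = \sum_i \sum_j K (@tagnat.Rank n k i j).
Proof. exact: sum_Rank_cond. Qed.
End BlockSums.

Lemma ltn_Rank n (k : 'I_n -> nat) i i' (j : 'I_(k i)) (j' : 'I_(k i')) :
  (Rank j' < Rank j) = (i' < i) || (i' == i) && (j' < j).
Proof.
have lt_Rank a b (u : 'I_(k a)) (v : 'I_(k b)) :
    a < b -> Rank u < Rank v.
  move=> ab; rewrite !tagnat.RankEsum.
  apply: leq_trans (leq_addr _ _).
  rewrite -addnS.
  rewrite [leqRHS](bigID (fun c : 'I_n => c < a)) /= leq_add//.
    rewrite leq_eqVlt; apply/orP; left; apply/eqP; apply: eq_bigl => c.
    by case: (ltnP c a); rewrite ?andbF// => /ltn_trans->.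
  apply: leq_trans (ltn_ord u) _.
  by rewrite (bigD1 a) ?ab ?ltnn//= leq_addr.
case: (ltngtP i' i) => [lti|lti|/val_inj eqi].
- by rewrite lt_Rank.
- rewrite -val_eqE/= (gtn_eqF lti) andFb.
  by apply/negbTE; rewrite -leqNgt ltnW// lt_Rank.
- by case: i / eqi j => j; rewrite eqxx !tagnat.RankEsum ltn_add2l.
Qed.

Lemma sum_lex n (k : 'I_n -> nat) (A : pred 'I_n)
    (B : forall i, pred 'I_(k i)) (F : forall i, 'I_(k i) -> nat) i :
  ~~ A i ->
  \sum_a \sum_(b | A a || (a == i) && B a b) F a b =
  \sum_(a | A a) \sum_b F a b + \sum_(b | B i b) F i b.
Proof.
move=> nA; rewrite (bigD1 i)//= (negbTE nA) eqxx /= addnC; congr (_ + _).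
rewrite big_mkcond [RHS]big_mkcond /=; apply: eq_bigr => a _.
case: eqVneq => [->|_] /=; first by rewrite (negbTE nA).
by case: (A a); [apply: eq_bigl|rewrite big1//].
Qed.

(* Composition of permutations in the order [sigma tau] = first [tau], then
   [sigma]; MathComp's [*] composes left to right. *)
Definition pmul n (sigma tau : 'S_n) : 'S_n := (tau * sigma)%g.

Lemma pmulE n (s t : 'S_n) i : pmul s t i = s (t i).
Proof. by rewrite permM. Qed.

(* A point [i] of the [j]-th block of [{0, ..., \sum_i k i - 1}] is
   [Rank i]; conversely [p] lies in the block [tagnat.sig1 p], at
   position [tagnat.sig2 p]. *)
Section Block.
Variables (n : nat) (sigma : 'S_n) (k : 'I_n -> nat).

Definition block_start (j : 'I_n) : nat := \sum_(l | sigma l < sigma j) k l.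

Lemma block_start_lt j j' :
  sigma j < sigma j' -> block_start j + k j <= block_start j'.
Proof.
move=> lt_jj'; rewrite /block_start [leqRHS](bigD1 j) //= addnC leq_add2l.
rewrite [leqRHS](bigID (fun l : 'I_n => sigma l < sigma j)) /=.
apply: leq_trans (leq_addr _ _).
rewrite leq_eqVlt; apply/orP; left; apply/eqP; apply: eq_bigl => l.
case: (ltnP (sigma l) (sigma j)); rewrite ?andbF// => lt_lj.
rewrite (ltn_trans lt_lj lt_jj') /=.
by case: eqVneq lt_lj => [->|//]; rewrite ltnn.
Qed.

Lemma block_subproof (p : 'I_(\sum_i k i)) :
  tagnat.sig2 p + block_start (tagnat.sig1 p) < \sum_i k i.
Proof.
set j := tagnat.sig1 p; rewrite /block_start.
rewrite [ltnRHS](bigID (fun l => sigma l < sigma j)) /= addnC ltn_add2l.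
by apply: leq_trans (ltn_ord _) _; rewrite (bigD1 j) ?ltnn//= leq_addr.
Qed.

Definition block_fun (p : 'I_(\sum_i k i)) : 'I_(\sum_i k i) :=
  Ordinal (block_subproof p).

Lemma block_fun_Rank j (i : 'I_(k j)) :
  block_fun (Rank i) = i + block_start j :> nat.
Proof. by rewrite /block_fun /= tagnat.Rank2K /= tagnat.Rank1K. Qed.

Lemma block_fun_inj : injective block_fun.
Proof.
move=> p p'; have [j [i ->]] := RankP p; have [j' [i' ->]] := RankP p'.
move=> /(congr1 val); rewrite [LHS]block_fun_Rank [RHS]block_fun_Rank => E.
have [lt|lt|/val_inj/perm_inj eqj] := ltngtP (sigma j) (sigma j').
- have := leq_trans (block_start_lt lt) (leq_addl i' _).
  by rewrite -E addnC leq_add2r leqNgt ltn_ord.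
- have := leq_trans (block_start_lt lt) (leq_addl i _).
  by rewrite E addnC leq_add2r leqNgt ltn_ord.
case: j' / eqj i' E => i' /eqP; rewrite eqn_add2r => /eqP/val_inj ->//.
Qed.

(* [sigma<k_1, ..., k_n>] *)
Definition block_perm : 'S_(\sum_i k i) := perm block_fun_inj.

Lemma block_permE j (i : 'I_(k j)) :
  block_perm (Rank i) = i + block_start j :> nat.
Proof. by rewrite permE block_fun_Rank. Qed.
End Block.

Section BlockSum.
Variables (n : nat) (k : 'I_n -> nat) (tau : forall i, 'S_(k i)).

Definition block_sum_fun (p : 'I_(\sum_i k i)) : 'I_(\sum_i k i) :=
  Rank (tau (tagnat.sig1 p) (tagnat.sig2 p)).

Lemma block_sum_fun_Rank j (i : 'I_(k j)) :
  block_sum_fun (Rank i) = Rank (tau j i).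
Proof.
rewrite /block_sum_fun.
have H (u : {i & 'I_(k i)}) : Rank (tau (tag u) (tagged u)) =
    tagnat.rank (Tagged (fun i => 'I_(k i)) (tau (tag u) (tagged u))) by [].
by rewrite /tagnat.sig1 /tagnat.sig2 H /Rank tagnat.rankK.
Qed.

Lemma block_sum_fun_inj : injective block_sum_fun.
Proof.
move=> p p'; have [j [i ->]] := RankP p; have [j' [i' ->]] := RankP p'.
rewrite !block_sum_fun_Rank => /(congr1 val)/eqP.
rewrite /= tagnat.eq_Rank => /andP[/eqP eqj].
by case: j' / eqj i' => i' /eqP/val_inj/perm_inj->.
Qed.

(* [tau_1 (+) ... (+) tau_n] *)
Definition block_sum : 'S_(\sum_i k i) := perm block_sum_fun_inj.

Lemma block_sumE j (i : 'I_(k j)) :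
  block_sum (Rank i) = Rank (tau j i).
Proof. by rewrite permE block_sum_fun_Rank. Qed.
End BlockSum.

(* [sigma<tau_1, ..., tau_n>] *)
Definition perm_gamma n (k : 'I_n -> nat) (sigma : 'S_n)
    (tau : forall i, 'S_(k i)) : 'S_(\sum_i k i) :=
  pmul (block_perm sigma k) (block_sum tau).

Lemma perm_gammaE n (k : 'I_n -> nat) (s : 'S_n) (t : forall i, 'S_(k i))
    j (i : 'I_(k j)) :
  perm_gamma s t (Rank i) = t j i + block_start s k j :> nat.
Proof. by rewrite pmulE block_sumE block_permE. Qed.

Lemma perm_gamma_lt n (k : 'I_n -> nat) (s : 'S_n) (t : forall i, 'S_(k i))
    j j' (i : 'I_(k j)) (i' : 'I_(k j')) :
  (perm_gamma s t (Rank i') < perm_gamma s t (Rank i)) =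
  (s j' < s j) || (j' == j) && (t j' i' < t j i).
Proof.
rewrite !perm_gammaE.
have H a b (u : 'I_(k a)) (v : 'I_(k b)) : s a < s b ->
    u + block_start s k a < v + block_start s k b.
  move=> lt; apply: leq_trans (leq_addl _ _).
  apply: leq_trans (block_start_lt k lt).
  by rewrite addnC ltn_add2l.
case: (ltngtP (s j') (s j)) => [lt|lt|/val_inj/perm_inj eqj] /=.
- exact: H.
- apply/idP/idP => [|/andP[/eqP E]]; last by rewrite E ltnn in lt.
  by rewrite ltnNge ltnW// H.
- by case: j / eqj i => i; rewrite eqxx ltn_add2r.
Qed.

Lemma castn_perm_val m n (e : m = n) (s : 'S_m) (i : 'I_m) :
  castn (T := fun n => 'S_n) e s (cast_ord e i) = s i :> nat.
Proof. by case: n / e; rewrite castn_id cast_ord_id. Qed.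

Lemma castn_permP m n (e : m = n) (s : 'S_m) (t : 'S_n) :
  (forall i, s i = t (cast_ord e i) :> nat) ->
  castn (T := fun n => 'S_n) e s = t.
Proof.
case: n / e t => t H; rewrite castn_id; apply/permP => i; apply: val_inj.
by rewrite /= H cast_ord_id.
Qed.

Section PermGammaLaws.

Lemma sum_perm n (k : 'I_n -> nat) (sigma : 'S_n) :
  \sum_i k ((sigma^-1)%g i) = \sum_i k i.
Proof. by rewrite [RHS](reindex_perm sigma^-1). Qed.

Lemma sum_const1 n : \sum_(i < n) 1 = n.
Proof. by rewrite sum1_card card_ord. Qed.

Lemma sum_ord1 (k : 'I_1 -> nat) : \sum_i k i = k ord0.
Proof. exact: big_ord1. Qed.

Lemma Rank_Rank n (k : 'I_n -> nat) (K : 'I_(\sum_i k i) -> nat)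
    i (j : 'I_(k i)) (m : 'I_(K (Rank j))) :
  Rank m =
  @tagnat.Rank n (fun i => \sum_j K (@tagnat.Rank n k i j)) i
    (@tagnat.Rank (k i) (fun j => K (Rank j)) j m) :> nat.
Proof.
rewrite [LHS]tagnat.RankEsum [RHS]tagnat.RankEsum.
rewrite [X in _ = _ + X]tagnat.RankEsum addnA; congr (_ + _).
rewrite sum_Rank_cond.
under eq_bigr => a _ do under eq_bigl => b do rewrite ltn_Rank.
apply: (@sum_lex n k (fun a : 'I_n => a < i) (fun a (b : 'I_(k a)) => b < j)).
by rewrite ltnn.
Qed.

Lemma perm_gammaA n (k : 'I_n -> nat) (K : 'I_(\sum_i k i) -> nat)
    (s : 'S_n) (t : forall i, 'S_(k i)) (r : forall p, 'S_(K p)) :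
  castn (T := fun n => 'S_n) (sum_Rank K)
    (perm_gamma (perm_gamma s t) r) =
  perm_gamma s (fun i => perm_gamma (t i) (fun j => r (Rank j))).
Proof.
apply: castn_permP => q.
have [p [m ->]] := RankP q; have [i [j E]] := RankP p.
subst p; rewrite perm_gammaE.
set q' := cast_ord _ _.
have -> : q' = Rank
    (@tagnat.Rank (k i) (fun j => K (Rank j)) j m).
  by apply: val_inj; apply: Rank_Rank.
rewrite !perm_gammaE -addnA; congr (_ + _).
rewrite /block_start sum_Rank_cond addnC.
under eq_bigr => a _ do under eq_bigl => b do rewrite perm_gamma_lt.
apply: (@sum_lex n k (fun a : 'I_n => s a < s i)
  (fun a (b : 'I_(k a)) => t a b < t i j)).
by rewrite ltnn.
Qed.

Lemma perm_gamma_block n (k : 'I_n -> nat) (s t : 'S_n)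
    (r : forall i, 'S_(k i)) :
  perm_gamma (pmul s t) r =
  pmul (castn (T := fun n => 'S_n) (sum_perm k t)
         (perm_gamma s (fun i => r ((t^-1)%g i)))) (block_perm t k).
Proof.
apply/permP => p; apply: val_inj; rewrite pmulE /=.
have [j [i ->]] := RankP p.
have Ej : j = (t^-1)%g (t j) by rewrite permK.
move: (t j) Ej => j' Ej; subst j.
rewrite perm_gammaE.
pose q := @tagnat.Rank n (fun i => k ((t^-1)%g i)) j' i.
have -> : block_perm t k (Rank i) = cast_ord (sum_perm k t) q.
  apply: val_inj; apply: etrans (block_permE _ _) _.
  apply: etrans (esym (tagnat.RankEsum _)); rewrite addnC; congr (_ + _).
  rewrite /block_start [LHS](reindex_perm t^-1) /=.
  by apply: eq_bigl => l; rewrite !permKV.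
rewrite castn_perm_val perm_gammaE; congr (_ + _).
rewrite /block_start [LHS](reindex_perm t^-1) /=.
by apply: eq_bigl => l; rewrite !pmulE !permKV.
Qed.

Lemma perm_gamma_sum n (k : 'I_n -> nat) (s : 'S_n)
    (t r : forall i, 'S_(k i)) :
  perm_gamma s (fun i => pmul (t i) (r i)) =
  pmul (perm_gamma s t) (block_sum r).
Proof.
apply/permP => p; have [j [i ->]] := RankP p; apply: val_inj.
by rewrite pmulE block_sumE /= !perm_gammaE pmulE.
Qed.

Lemma perm_gamma1l (k : 'I_1 -> nat) (t : forall i, 'S_(k i)) :
  castn (T := fun n => 'S_n) (sum_ord1 k) (perm_gamma 1%g t) = t ord0.
Proof.
apply: castn_permP => p; have [j [i ->]] := RankP p.
move: i; rewrite (ord1 j) => i.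
rewrite perm_gammaE /block_start big_pred0; last by move=> l; rewrite !ord1 ltnn.
rewrite addn0; congr (val (t _ _)); apply: val_inj.
by apply: etrans (esym (tagnat.RankEsum _)); rewrite big_pred0.
Qed.

Lemma perm_gamma1r n (s : 'S_n) :
  castn (T := fun n => 'S_n) (sum_const1 n) (perm_gamma s (fun=> 1%g : 'S_1)) = s.
Proof.
have card_lt (m : 'I_n) : \sum_(l < n | l < m) 1 = m.
  by rewrite -(big_ord_widen _ (fun=> 1)) ?sum_const1// ltnW.
apply: castn_permP => p; have [j [i ->]] := RankP p.
rewrite perm_gammaE perm1 (ord1 i) /= /block_start.
have -> : cast_ord (sum_const1 n) (@tagnat.Rank n (fun=> 1) j ord0) = j.
  apply: val_inj; apply: etrans (tagnat.RankEsum _) _.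
  by rewrite addn0 card_lt.
rewrite (reindex_perm s^-1) /=.
by under eq_bigl do rewrite permKV; rewrite add0n card_lt.
Qed.
End PermGammaLaws.

Lemma perm_gamma_ext n (k : 'I_n -> nat) (s : 'S_n) (t t' : forall i, 'S_(k i)) :
  (forall i, t i = t' i) -> perm_gamma s t = perm_gamma s t'.
Proof. by move=> E; congr perm_gamma; apply: functional_extensionality_dep. Qed.

(* In [op_gammaA] the operations [z] plugged into the composite [op_gamma x y]
   are indexed by its [\sum_i k i] inputs, so [z (tagnat.Rank i j)] goes into
   the [j]-th input of [y i].  [op_gamma_block] and [op_gamma_sum] are the two
   equivariance laws of a symmetric operad with right actions. *)
Record operad (gT : finGroupType) := Operad {
  op_carrier :> nat -> Type;
  op_gact : gT -> forall n, op_carrier n -> op_carrier n;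
  op_sact : forall n, op_carrier n -> 'S_n -> op_carrier n;
  op_one : op_carrier 1;
  op_gamma : forall n (k : 'I_n -> nat),
    op_carrier n -> (forall i, op_carrier (k i)) -> op_carrier (\sum_i k i);
  op_gact1 : forall n (x : op_carrier n), op_gact 1%g x = x;
  op_gactM : forall g h n (x : op_carrier n),
    op_gact (g * h)%g x = op_gact g (op_gact h x);
  op_sact1 : forall n (x : op_carrier n), op_sact x 1%g = x;
  op_sactM : forall n (x : op_carrier n) (s t : 'S_n),
    op_sact x (pmul s t) = op_sact (op_sact x s) t;
  op_gact_sact : forall g n (x : op_carrier n) (s : 'S_n),
    op_gact g (op_sact x s) = op_sact (op_gact g x) s;
  op_gact_one : forall g, op_gact g op_one = op_one;
  op_gact_gamma : forall g n (k : 'I_n -> nat) (x : op_carrier n)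
      (y : forall i, op_carrier (k i)),
    op_gact g (op_gamma x y) =
    op_gamma (op_gact g x) (fun i => op_gact g (y i));
  op_gamma1l : forall (k : 'I_1 -> nat) (y : forall i, op_carrier (k i)),
    castn (sum_ord1 k) (op_gamma op_one y) = y ord0;
  op_gamma1r : forall n (x : op_carrier n),
    castn (sum_const1 n) (op_gamma x (fun=> op_one)) = x;
  op_gammaA : forall n (k : 'I_n -> nat) (K : 'I_(\sum_i k i) -> nat)
      (x : op_carrier n) (y : forall i, op_carrier (k i))
      (z : forall p, op_carrier (K p)),
    castn (sum_Rank K) (op_gamma (op_gamma x y) z) =
    op_gamma x (fun i => op_gamma (y i) (fun j => z (tagnat.Rank i j)));
  op_gamma_block : forall n (k : 'I_n -> nat) (x : op_carrier n) (s : 'S_n)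
      (y : forall i, op_carrier (k i)),
    op_gamma (op_sact x s) y =
    op_sact
      (castn (sum_perm k s) (op_gamma x (fun i => y ((s^-1)%g i))))
      (block_perm s k);
  op_gamma_sum : forall n (k : 'I_n -> nat) (x : op_carrier n)
      (y : forall i, op_carrier (k i)) (t : forall i, 'S_(k i)),
    op_gamma x (fun i => op_sact (y i) (t i)) =
    op_sact (op_gamma x y) (block_sum t)
}.

Arguments op_gact {gT o} g {n} x.
Arguments op_sact {gT o n} x s.
Arguments op_one {gT o}.
Arguments op_gamma {gT o n k} x y.

Section Morphisms.
Variable gT : finGroupType.

Record operad_hom (O O' : operad gT) := OperadHom {
  op_hom_fun :> forall n, O n -> O' n;
  op_hom_gact : forall g n (x : O n),
    op_hom_fun (op_gact g x) = op_gact g (op_hom_fun x);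
  op_hom_sact : forall n (x : O n) (s : 'S_n),
    op_hom_fun (op_sact x s) = op_sact (op_hom_fun x) s;
  op_hom_one : op_hom_fun (@op_one _ O) = op_one;
  op_hom_gamma : forall n (k : 'I_n -> nat) (x : O n) (y : forall i, O (k i)),
    op_hom_fun (op_gamma x y) =
    op_gamma (op_hom_fun x) (fun i => op_hom_fun (y i))
}.

Definition operad_iso (O O' : operad gT) : Prop :=
  exists (f : operad_hom O O') (f' : operad_hom O' O),
    (forall n, cancel (@f n) (@f' n)) /\ (forall n, cancel (@f' n) (@f n)).
End Morphisms.

Lemma castn_map (T U : nat -> Type) (f : forall n, T n -> U n) m n (e : m = n)
    (x : T m) :
  f n (castn e x) = castn e (f m x).
Proof. by case: n / e. Qed.

Section PG.
Variable gT : finGroupType.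

Definition P_carrier (n : nat) : Type := {ffun gT -> 'S_n}.

Definition P_gact (g : gT) n (f : P_carrier n) : P_carrier n :=
  [ffun h => f (h * g)%g].

Definition P_sact n (f : P_carrier n) (s : 'S_n) : P_carrier n :=
  [ffun h => pmul (f h) s].

Definition P_one : P_carrier 1 := [ffun=> 1%g].

Definition P_gamma n (k : 'I_n -> nat) (f : P_carrier n)
    (fs : forall i, P_carrier (k i)) : P_carrier (\sum_i k i) :=
  [ffun h => perm_gamma (f h) (fun i => fs i h)].

Lemma castn_ffun m n (e : m = n) (f : P_carrier m) h :
  castn (T := P_carrier) e f h = castn (T := fun n => 'S_n) e (f h).
Proof. by case: n / e. Qed.

Definition P_operad : operad gT.
Proof.
refine (@Operad gT P_carrier P_gact P_sact P_one P_gamma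
  _ _ _ _ _ _ _ _ _ _ _ _).
- by move=> n x; apply/ffunP => h; rewrite ffunE mulg1.
- by move=> g g' n x; apply/ffunP => h; rewrite !ffunE mulgA.
- by move=> n x; apply/ffunP => h; rewrite ffunE /pmul mul1g.
- by move=> n x s t; apply/ffunP => h; rewrite !ffunE /pmul mulgA.
- by move=> g n x s; apply/ffunP => h; rewrite !ffunE.
- by move=> g; apply/ffunP => h; rewrite !ffunE.
- move=> g n k x y; apply/ffunP => h; rewrite !ffunE.
  by apply: perm_gamma_ext => i; rewrite ffunE.
- move=> k y; apply/ffunP => h; rewrite castn_ffun !ffunE.
  exact: perm_gamma1l.
- move=> n x; apply/ffunP => h; rewrite castn_ffun !ffunE.
  exact: perm_gamma1r.
- move=> n k K x y z; apply/ffunP => h; rewrite castn_ffun !ffunE.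
  by rewrite perm_gammaA; apply: perm_gamma_ext => i; rewrite ffunE.
- move=> n k x s y; apply/ffunP => h; rewrite !ffunE castn_ffun !ffunE.
  exact: perm_gamma_block.
- move=> n k x y t; apply/ffunP => h; rewrite !ffunE -perm_gamma_sum.
  by apply: perm_gamma_ext => i; rewrite ffunE.
Defined.
End PG.

Section SubOperads.
Variables (gT : finGroupType) (O : operad gT).

Record suboperad := SubOperad {
  sub_mem :> forall n, O n -> Prop;
  sub_gact : forall g n (x : O n), sub_mem x -> sub_mem (op_gact g x);
  sub_sact : forall n (x : O n) (s : 'S_n), sub_mem x -> sub_mem (op_sact x s);
  sub_one : sub_mem (@op_one _ O);
  sub_gamma : forall n (k : 'I_n -> nat) (x : O n) (y : forall i, O (k i)),
    sub_mem x -> (forall i, sub_mem (y i)) -> sub_mem (op_gamma x y)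
}.

Definition gen_sub_mem (X : forall n, O n -> Prop) n (x : O n) : Prop :=
  forall Q : suboperad, (forall m (u : O m), X m u -> Q m u) -> Q n x.

Definition gen_suboperad (X : forall n, O n -> Prop) : suboperad.
Proof.
refine (@SubOperad (gen_sub_mem X) _ _ _ _).
- by move=> g n x Xx Q XQ; apply: sub_gact; apply: Xx.
- by move=> n x s Xx Q XQ; apply: sub_sact; apply: Xx.
- by move=> Q XQ; apply: sub_one.
- by move=> n k x y Xx Xy Q XQ; apply: sub_gamma => [|i]; [apply: Xx|apply: Xy].
Defined.

Variable Q : suboperad.

Definition sub_carrier n : Type := {x : O n | Q n x}.

Lemma sub_val_inj n (x y : sub_carrier n) : sval x = sval y -> x = y.
Proof. by case: x y => [x Qx] [y Qy] /= E; apply: eq_exist. Qed.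

Definition suboperad_operad : operad gT.
Proof.
refine (@Operad gT sub_carrier
  (fun g n x => exist _ (op_gact g (sval x)) (sub_gact g (proj2_sig x)))
  (fun n x s => exist _ (op_sact (sval x) s) (sub_sact s (proj2_sig x)))
  (exist _ op_one (sub_one Q))
  (fun n k x y => exist _ (op_gamma (sval x) (fun i => sval (y i)))
     (sub_gamma (proj2_sig x) (fun i => proj2_sig (y i))))
  _ _ _ _ _ _ _ _ _ _ _ _); intros; apply: sub_val_inj;
  rewrite ?(castn_map (fun n (u : sub_carrier n) => sval u)) /=
    ?(castn_map (fun n (u : sub_carrier n) => sval u)) /=.
- exact: op_gact1.
- exact: op_gactM.
- exact: op_sact1.
- exact: op_sactM.
- exact: op_gact_sact.
- exact: op_gact_one.
- exact: op_gact_gamma.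
- exact: op_gamma1l.
- exact: op_gamma1r.
- exact: op_gammaA.
- exact: op_gamma_block.
- exact: op_gamma_sum.
Defined.
End SubOperads.

Section Quotients.
Variables (gT : finGroupType) (O : operad gT).

Record congruence := Congruence {
  cong_rel :> forall n, O n -> O n -> Prop;
  cong_refl : forall n (x : O n), cong_rel x x;
  cong_sym : forall n (x y : O n), cong_rel x y -> cong_rel y x;
  cong_trans : forall n (x y z : O n),
    cong_rel x y -> cong_rel y z -> cong_rel x z;
  cong_gact : forall g n (x y : O n),
    cong_rel x y -> cong_rel (op_gact g x) (op_gact g y);
  cong_sact : forall n (x y : O n) (s : 'S_n),
    cong_rel x y -> cong_rel (op_sact x s) (op_sact y s);
  cong_gamma : forall n (k : 'I_n -> nat) (x x' : O n)
      (y y' : forall i, O (k i)),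
    cong_rel x x' -> (forall i, cong_rel (y i) (y' i)) ->
    cong_rel (op_gamma x y) (op_gamma x' y')
}.

Definition gen_cong_rel (R : forall n, O n -> O n -> Prop) n (x y : O n) :
    Prop :=
  forall C : congruence,
    (forall m (u v : O m), R m u v -> C m u v) -> C n x y.

Definition gen_congruence (R : forall n, O n -> O n -> Prop) : congruence.
Proof.
refine (@Congruence (gen_cong_rel R) _ _ _ _ _ _).
- by move=> n x C RC; apply: cong_refl.
- by move=> n x y Rxy C RC; apply: cong_sym; apply: Rxy.
- by move=> n x y z Rxy Ryz C RC; apply: (@cong_trans C n x y z);
    [apply: Rxy|apply: Ryz].
- by move=> g n x y Rxy C RC; apply: cong_gact; apply: Rxy.
- by move=> n x y s Rxy C RC; apply: cong_sact; apply: Rxy.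
- by move=> n k x x' y y' Rx Ry C RC; apply: cong_gamma => [|i];
    [apply: Rx|apply: Ry].
Defined.

Variable C : congruence.

Definition cong_bool n : rel {classic (O n)} := fun x y => `[< C n x y >].

Lemma cong_bool_refl n : reflexive (@cong_bool n).
Proof. by move=> x; apply/asboolP; apply: cong_refl. Qed.

Lemma cong_bool_sym n : symmetric (@cong_bool n).
Proof. by move=> x y; apply/asboolP/asboolP => H; apply: cong_sym. Qed.

Lemma cong_bool_trans n : transitive (@cong_bool n).
Proof.
by move=> y x z /asboolP xy /asboolP yz; apply/asboolP; apply: cong_trans yz.
Qed.

Canonical cong_equiv n :=
  EquivRel (@cong_bool n) (@cong_bool_refl n) (@cong_bool_sym n)
    (@cong_bool_trans n).

Definition quot_carrier n : Type := {eq_quot (cong_equiv n)}.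

Definition quot_pi n (x : O n) : quot_carrier n :=
  \pi_({eq_quot (cong_equiv n)}) (x : {classic (O n)}).

Definition quot_repr n (x : quot_carrier n) : O n :=
  generic_quotient.repr (x : {eq_quot (cong_equiv n)}).

Lemma quot_reprK n (x : quot_carrier n) : quot_pi (quot_repr x) = x.
Proof. exact: reprK. Qed.

Lemma quot_piP n (x y : O n) : quot_pi x = quot_pi y <-> C n x y.
Proof.
split=> [/eqmodP/asboolP//|Cxy].
by apply/eqmodP/asboolP.
Qed.

Definition quot_gact (g : gT) n (x : quot_carrier n) : quot_carrier n :=
  quot_pi (op_gact g (quot_repr x)).

Definition quot_sact n (x : quot_carrier n) (s : 'S_n) : quot_carrier n :=
  quot_pi (op_sact (quot_repr x) s).

Definition quot_gamma n (k : 'I_n -> nat) (x : quot_carrier n)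
    (y : forall i, quot_carrier (k i)) : quot_carrier (\sum_i k i) :=
  quot_pi (op_gamma (quot_repr x) (fun i => quot_repr (y i))).

Lemma quot_repr_pi n (x : O n) : C n (quot_repr (quot_pi x)) x.
Proof. by apply/quot_piP; rewrite quot_reprK. Qed.

Lemma quot_gact_pi g n (x : O n) :
  quot_gact g (quot_pi x) = quot_pi (op_gact g x).
Proof. by apply/quot_piP/cong_gact/quot_repr_pi. Qed.

Lemma quot_sact_pi n (x : O n) (s : 'S_n) :
  quot_sact (quot_pi x) s = quot_pi (op_sact x s).
Proof. by apply/quot_piP/cong_sact/quot_repr_pi. Qed.

Lemma quot_gamma_pi n (k : 'I_n -> nat) (x : O n) (y : forall i, O (k i)) :
  quot_gamma (quot_pi x) (fun i => quot_pi (y i)) = quot_pi (op_gamma x y).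
Proof.
by apply/quot_piP; apply: cong_gamma => [|i]; apply: quot_repr_pi.
Qed.

Lemma quot_ind n (P : quot_carrier n -> Prop) :
  (forall x, P (quot_pi x)) -> forall x, P x.
Proof. by move=> H x; rewrite -(quot_reprK x). Qed.

Lemma quot_ind_fam n (k : 'I_n -> nat)
    (P : (forall i, quot_carrier (k i)) -> Prop) :
  (forall y : forall i, O (k i), P (fun i => quot_pi (y i))) -> forall y, P y.
Proof.
move=> H y; have -> : y = fun i => quot_pi (quot_repr (y i)).
  by apply: functional_extensionality_dep => i; rewrite quot_reprK.
exact: H.
Qed.

Lemma castn_quot m n (e : m = n) (x : O m) :
  castn e (quot_pi x) = quot_pi (castn e x).
Proof. by case: n / e. Qed.

Definition quotient_operad : operad gT.
Proof.
refine (@Operad gT quot_carrier quot_gact quot_sact (quot_pi op_one) quot_gamma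
  _ _ _ _ _ _ _ _ _ _ _ _).
- by move=> n; elim/quot_ind => x; rewrite quot_gact_pi op_gact1.
- by move=> g h n; elim/quot_ind => x; rewrite !quot_gact_pi op_gactM.
- by move=> n; elim/quot_ind => x; rewrite quot_sact_pi op_sact1.
- by move=> n + s t; elim/quot_ind => x; rewrite !quot_sact_pi op_sactM.
- move=> g n + s; elim/quot_ind => x.
  by rewrite quot_gact_pi !quot_sact_pi quot_gact_pi op_gact_sact.
- by move=> g; rewrite quot_gact_pi op_gact_one.
- move=> g n k + +; elim/quot_ind => x; elim/quot_ind_fam => y.
  rewrite quot_gamma_pi !quot_gact_pi op_gact_gamma -quot_gamma_pi.
  congr quot_gamma; apply: functional_extensionality_dep => i.
  by rewrite quot_gact_pi.
- move=> k; elim/quot_ind_fam => y.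
  by rewrite quot_gamma_pi castn_quot op_gamma1l.
- move=> n; elim/quot_ind => x.
  by rewrite quot_gamma_pi castn_quot op_gamma1r.
- move=> n k K + + +; elim/quot_ind => x.
  elim/quot_ind_fam => y; elim/quot_ind_fam => z.
  rewrite (quot_gamma_pi x y) (quot_gamma_pi (op_gamma x y) z) castn_quot.
  rewrite op_gammaA -quot_gamma_pi.
  congr quot_gamma; apply: functional_extensionality_dep => i.
  by rewrite quot_gamma_pi.
- move=> n k + s +; elim/quot_ind => x; elim/quot_ind_fam => y.
  rewrite quot_sact_pi !quot_gamma_pi castn_quot quot_sact_pi.
  by rewrite op_gamma_block.
- move=> n k + + t; elim/quot_ind => x; elim/quot_ind_fam => y.
  rewrite quot_gamma_pi quot_sact_pi -op_gamma_sum -quot_gamma_pi.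
  congr quot_gamma; apply: functional_extensionality_dep => i.
  by rewrite quot_sact_pi.
Defined.
End Quotients.

(* Planar rooted trees with [n] leaves and [k]-ary nodes labelled by [L k].
   Isomorphic labelled planar trees are equal as elements of this inductive
   type, so there are no isomorphism classes to take. *)
Section Trees.
Variable L : nat -> Type.

Inductive tree : nat -> Type :=
| Leaf : tree 1
| Node k (l : L k) (a : 'I_k -> nat) (t : forall i, tree (a i)) :
    tree (\sum_i a i).

Fixpoint graft n (t : tree n) :
    forall k : 'I_n -> nat, (forall i, tree (k i)) -> tree (\sum_i k i) :=
  match t in tree n return
    forall k : 'I_n -> nat, (forall i, tree (k i)) -> tree (\sum_i k i) with
  | Leaf => fun k y => castn (esym (sum_ord1 k)) (y ord0)
  | Node m l a ts => fun k y =>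
      castn (esym (sum_Rank k))
        (Node l (fun i => graft (ts i) (fun j => y (tagnat.Rank i j))))
  end.

Lemma tag_graft n n' (t : tree n) (t' : tree n') (k : 'I_n -> nat)
    (k' : 'I_n' -> nat) (y : forall i, tree (k i)) (y' : forall i, tree (k' i))
    (e : n = n') :
  Tagged tree t = Tagged tree t' ->
  (forall i, Tagged tree (y i) = Tagged tree (y' (cast_ord e i))) ->
  Tagged tree (graft t y) = Tagged tree (graft t' y').
Proof.
exact: (@tag_dep tree tree tree (fun n k => \sum_(i < n) k i)
  (fun n k x y => graft x y)).
Qed.

Lemma tag_Node n (l : L n) (k k' : 'I_n -> nat)
    (y : forall i, tree (k i)) (y' : forall i, tree (k' i)) :
  (forall i, Tagged tree (y i) = Tagged tree (y' i)) ->
  Tagged tree (Node l y) = Tagged tree (Node l y').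
Proof.
move=> E.
apply: (@tag_dep L tree tree (fun n k => \sum_(i < n) k i)
  (fun n k l y => Node l y) n n l l k k' y y' (erefl n)) => // i.
by rewrite E cast_ord_id.
Qed.

Lemma tag_graftr n (t : tree n) (k k' : 'I_n -> nat)
    (y : forall i, tree (k i)) (y' : forall i, tree (k' i)) :
  (forall i, Tagged tree (y i) = Tagged tree (y' i)) ->
  Tagged tree (graft t y) = Tagged tree (graft t y').
Proof.
by move=> E; apply: (@tag_graft _ _ _ _ _ _ _ _ (erefl n)) => // i;
  rewrite E cast_ord_id.
Qed.

Lemma graft_leaf n (t : tree n) :
  Tagged tree (graft t (fun=> Leaf)) = Tagged tree t.
Proof.
elim: t => [|k l a t IH] /=; first by rewrite tag_castn.
by rewrite tag_castn; apply: tag_Node.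
Qed.

Lemma tag_fam (T : nat -> Type) n (k : 'I_n -> nat) (y : forall i, T (k i)) i j :
  i = j -> Tagged T (y i) = Tagged T (y j).
Proof. by move->. Qed.

Lemma graftA n (t : tree n) (k : 'I_n -> nat) (y : forall i, tree (k i))
    (K : 'I_(\sum_i k i) -> nat) (z : forall p, tree (K p)) :
  Tagged tree (graft (graft t y) z) =
  Tagged tree (graft t (fun i => graft (y i) (fun j => z (Rank j)))).
Proof.
elim: t k y K z => [|m l a t IH] k y K z /=.
- rewrite tag_castn; apply: (tag_graft (e := sum_ord1 k)).
    by rewrite tag_castn.
  move=> p; have [i [j ->]] := RankP p; move: j; rewrite (ord1 i) => j.
  apply: tag_fam; congr (Rank _); apply: val_inj.
  by apply/esym; apply: etrans (tagnat.RankEsum _) _; rewrite big_pred0.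
rewrite tag_castn.
set T0 := Node l _.
pose z0 p := z (cast_ord (esym (sum_Rank k)) p).
transitivity (Tagged tree (graft T0 z0)).
  apply: (tag_graft (e := sum_Rank k)); first by rewrite tag_castn.
  by move=> p; apply: tag_fam; rewrite cast_ordK.
rewrite /T0 /= tag_castn; apply: tag_Node => i.
rewrite IH; apply: tag_graftr => j; apply: tag_graftr => u.
apply: (@tag_fam _ _ _ z); apply: val_inj; exact/esym/Rank_Rank.
Qed.
End Trees.

Arguments Leaf {L}.

Lemma perm_gamma_inv n (k : 'I_n -> nat) (s : 'S_n) (t : forall i, 'S_(k i))
    i (j : 'I_(k ((s^-1)%g i))) :
  ((perm_gamma s t)^-1)%g
    (cast_ord (sum_perm k s)
       (@tagnat.Rank n (fun i => k ((s^-1)%g i)) i j)) =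
  Rank ((t ((s^-1)%g i))^-1%g j).
Proof.
apply: (@perm_inj _ (perm_gamma s t)); rewrite permKV; apply: val_inj.
rewrite [RHS]perm_gammaE permKV addnC; apply: etrans (tagnat.RankEsum _) _.
congr (_ + _); rewrite /block_start [RHS](reindex_perm s^-1) /=.
by apply: eq_bigl => l; rewrite !permKV.
Qed.

Section Free.
Variables (gT : finGroupType) (S : nat -> Type).

Definition label (k : nat) : Type := (gT * S k)%type.

Fixpoint tree_gact (g : gT) n (t : tree label n) : tree label n :=
  match t in tree _ n return tree label n with
  | Leaf => Leaf
  | Node _ l _ ts =>
      Node ((g * l.1)%g, l.2 : S _) (fun i => tree_gact g (ts i))
  end.

(* The pair [(t, s)] stands for the right translate of the planar tree [t] by
   the permutation [s] of its leaves; the formula for [free_gamma] is forced by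
   the two equivariance laws of [op_gamma]. *)
Definition free_carrier (n : nat) : Type := (tree label n * 'S_n)%type.

Definition free_gact (g : gT) n (x : free_carrier n) : free_carrier n :=
  (tree_gact g x.1, x.2).

Definition free_sact n (x : free_carrier n) (s : 'S_n) : free_carrier n :=
  (x.1, pmul x.2 s).

Definition free_one : free_carrier 1 := (Leaf, 1%g).

Definition free_gamma n (k : 'I_n -> nat) (x : free_carrier n)
    (y : forall i, free_carrier (k i)) : free_carrier (\sum_i k i) :=
  (castn (sum_perm k x.2) (graft x.1 (fun i => (y ((x.2^-1)%g i)).1)),
   perm_gamma x.2 (fun i => (y i).2)).

Lemma castn_pair m n (e : m = n) (x : free_carrier m) :
  castn e x = (castn e x.1, castn (T := fun n => 'S_n) e x.2).
Proof. by case: n / e; case: x. Qed.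

Lemma tree_gact_tag g m n (t : tree label m) (u : tree label n) :
  Tagged _ t = Tagged _ u -> Tagged _ (tree_gact g t) = Tagged _ (tree_gact g u).
Proof.
by move=> E; apply: (congr1 (fun v : {n & tree label n} =>
  Tagged _ (tree_gact g (tagged v))) E).
Qed.

Lemma tree_gact_graft g n (t : tree label n) (k : 'I_n -> nat)
    (y : forall i, tree label (k i)) :
  tree_gact g (graft t y) = graft (tree_gact g t) (fun i => tree_gact g (y i)).
Proof.
elim: t k y => [|m l a t IH] k y /=; rewrite (castn_map (tree_gact g))//.
congr castn => /=; congr Node.
by apply: functional_extensionality_dep => i; rewrite IH.
Qed.

Definition free_operad : operad gT.
Proof.
refine (@Operad gT free_carrier free_gact free_sact free_one free_gamma
  _ _ _ _ _ _ _ _ _ _ _ _).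
- move=> n [t s]; congr (_, _) => /=.
  elim: t {s} => [|k [g u] a t IH] //=; rewrite mul1g; congr Node.
  exact: functional_extensionality_dep.
- move=> g h n [t s]; congr (_, _) => /=.
  elim: t {s} => [|k [g' u] a t IH] //=; rewrite mulgA; congr Node.
  exact: functional_extensionality_dep.
- by move=> n [t s]; rewrite /free_sact /= /pmul mul1g.
- by move=> n [t r] s u; rewrite /free_sact /= /pmul mulgA.
- by [].
- by [].
- move=> g n k [t s] y; congr (_, _) => /=.
  by rewrite (castn_map (tree_gact g)) tree_gact_graft.
- move=> k y; rewrite castn_pair [RHS]surjective_pairing; congr (_, _).
    apply: castn_tag; rewrite /= !tag_castn.
    apply: (@tag_fam (tree label) _ _ (fun i => (y i).1)); exact: ord1.
  exact: perm_gamma1l.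
- move=> n [t s]; rewrite castn_pair; congr (_, _).
    by apply: castn_tag; rewrite /= tag_castn graft_leaf.
  exact: perm_gamma1r.
- move=> n k K [t s] y z; rewrite castn_pair; congr (_, _).
    apply: castn_tag; rewrite /= !tag_castn.
    pose z0 p := (z (((perm_gamma s (fun i => (y i).2))^-1)%g
      (cast_ord (sum_perm k s) p))).1.
    transitivity (Tagged (tree label)
      (graft (graft t (fun i => (y ((s^-1)%g i)).1)) z0)).
      apply: (tag_graft (e := esym (sum_perm k s))).
        by rewrite tag_castn.
      move=> p; rewrite /z0.
      apply: (@tag_fam (tree label) _ _ (fun p => (z p).1)).
      by rewrite cast_ordKV.
    rewrite graftA; apply: tag_graftr => i; rewrite /= tag_castn.
    apply: tag_graftr => j; rewrite /z0.
    apply: (@tag_fam (tree label) _ _ (fun p => (z p).1)).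
    exact: perm_gamma_inv.
  exact: perm_gammaA.
- move=> n k [t s] u y; rewrite castn_pair; congr (_, _).
    apply: tagI; rewrite /= !tag_castn; apply: tag_graftr => i.
    apply: (@tag_fam (tree label) _ _ (fun p => (y p).1)).
    by rewrite /pmul invMg permM.
  exact: perm_gamma_block.
- by move=> n k [t s] y u; congr (_, _); apply: perm_gamma_sum.
Defined.

(* The node labelled by [s] with its leaves in the planar order. *)
Definition free_gen n (s : S n) : free_operad n :=
  (castn (sum_const1 n) (@Node label n (1%g, s) _ (fun=> Leaf)), 1%g).

Section Universal.
Variables (O : operad gT) (phi : forall n, S n -> O n).

Fixpoint tree_eval n (t : tree label n) : O n :=
  match t in tree _ n return O n with
  | Leaf => op_one
  | Node _ l _ ts => op_gamma (op_gact l.1 (phi l.2)) (fun i => tree_eval (ts i))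
  end.

Lemma tree_eval_graft n (t : tree label n) (k : 'I_n -> nat)
    (y : forall i, tree label (k i)) :
  tree_eval (graft t y) = op_gamma (tree_eval t) (fun i => tree_eval (y i)).
Proof.
elim: t k y => [|m l a t IH] k y /=; rewrite (castn_map tree_eval).
- rewrite -(op_gamma1l (fun i => tree_eval (y i))); apply: castn_tag.
  by rewrite tag_castn.
- apply: castn_tag; rewrite -(tag_castn (sum_Rank k)) op_gammaA /=.
  congr (Tagged O (op_gamma _ _)).
  by apply: functional_extensionality_dep => i; rewrite IH.
Qed.

Lemma tree_eval_gact g n (t : tree label n) :
  tree_eval (tree_gact g t) = op_gact g (tree_eval t).
Proof.
elim: t => [|m l a t IH] /=; first by rewrite op_gact_one.
rewrite op_gact_gamma op_gactM; congr op_gamma.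
exact: functional_extensionality_dep.
Qed.

Definition free_hom : operad_hom free_operad O.
Proof.
refine (@OperadHom gT free_operad O
  (fun n (x : free_operad n) => op_sact (tree_eval x.1) x.2) _ _ _ _).
- by move=> g n x; rewrite /= tree_eval_gact op_gact_sact.
- by move=> n x s; rewrite /= op_sactM.
- by rewrite /= op_sact1.
- move=> n k [t s] y; rewrite op_gamma_sum op_gamma_block -op_sactM /=.
  congr op_sact; rewrite (castn_map tree_eval) tree_eval_graft //.
Defined.

Lemma free_operad_universal :
  exists f : operad_hom free_operad O,
    (forall n (s : S n), f n (free_gen s) = phi s) /\
    forall f' : operad_hom free_operad O,
      (forall n (s : S n), f' n (free_gen s) = phi s) ->
      forall n (x : free_operad n), f' n x = f n x.
Proof.
exists free_hom; split=> [n s|f' Hf'] /=.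
  by rewrite op_sact1 (castn_map tree_eval) /= op_gamma1r op_gact1.
suff H n (t : tree label n) : f' n (t, 1%g) = tree_eval t.
  move=> n [t s]; rewrite /= -H -op_hom_sact; congr (f' n _).
  by congr (_, _); rewrite /= /pmul mulg1.
elim: t => [|k [g s] a t IH] /=; first exact: op_hom_one.
rewrite -Hf' -op_hom_gact.
transitivity (f' _ (op_gamma (op_gact g (free_gen s))
    (fun i => (t i, 1%g) : free_operad (a i)))).
  congr (f' _ _); congr (_, _) => /=.
    apply: tagI; rewrite tag_castn (castn_map (tree_gact g)) /= mulg1.
    transitivity (Tagged (tree label)
      (graft (@Node label k (g, s) _ (fun=> Leaf))
         (fun i => t (cast_ord (sum_const1 k) i)))).
      rewrite /= tag_castn; apply: tag_Node => i; rewrite /= tag_castn.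
      apply: tag_fam; apply: val_inj; apply/esym.
      apply: etrans (tagnat.RankEsum _) _; rewrite addn0.
      by rewrite -(big_ord_widen _ (fun=> 1)) ?sum_const1// ltnW.
    apply: (tag_graft (e := sum_const1 k)); first by rewrite tag_castn.
    by move=> i; apply: tag_fam; rewrite invg1 perm1.
  apply/permP => p; have [j [i ->]] := RankP p; apply: val_inj.
  rewrite perm1; apply: etrans (tagnat.RankEsum _) _; apply/esym.
  apply: etrans (perm_gammaE _ _ _) _; rewrite perm1 addnC; congr (_ + _).
  by rewrite /block_start; apply: eq_bigl => l; rewrite !perm1.
rewrite op_hom_gamma; congr op_gamma.
exact: functional_extensionality_dep.
Qed.
End Universal.
End Free.

(* The arities [k1 + k2] and [k1 + k2 + k3] compute to numerals when the [k]s
   are numerals, which lets the relations below be stated without casts. *)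
Section ExplicitArguments.
Variables (gT : finGroupType) (O : operad gT).

Definition gamma_tuple n (x : O n) (ys : n.-tuple {k & O k}) :
    O (\sum_i tag (tnth ys i)) :=
  op_gamma x (fun i => tagged (tnth ys i)).

Lemma sum_tuple2 (T : nat -> Type) (u v : {k & T k}) :
  \sum_i tag (tnth [tuple u; v] i) = tag u + tag v.
Proof. by rewrite !big_ord_recr big_ord0. Qed.

Lemma sum_tuple3 (T : nat -> Type) (u v w : {k & T k}) :
  \sum_i tag (tnth [tuple u; v; w] i) = tag u + tag v + tag w.
Proof. by rewrite !big_ord_recr big_ord0. Qed.

Definition gamma2 (x : O 2) k1 k2 (y1 : O k1) (y2 : O k2) : O (k1 + k2) :=
  castn (sum_tuple2 (Tagged O y1) (Tagged O y2))
    (gamma_tuple x [tuple Tagged O y1; Tagged O y2]).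

Definition gamma3 (x : O 3) k1 k2 k3 (y1 : O k1) (y2 : O k2) (y3 : O k3) :
    O (k1 + k2 + k3) :=
  castn (sum_tuple3 (Tagged O y1) (Tagged O y2) (Tagged O y3))
    (gamma_tuple x [tuple Tagged O y1; Tagged O y2; Tagged O y3]).
End ExplicitArguments.

(* The cycle [1 |-> 2 |-> 3 |-> 1] and its inverse [1 |-> 3 |-> 2 |-> 1], on
   [{0, 1, 2}]. *)
Definition cycle123 : 'S_3 := perm (@ordS_inj 3).
Definition cycle132 : 'S_3 := perm (@ord_pred_inj 3).

(* For [g] a generator of a group [C3] of order 3, the last case of [Q_box] is
   [h = g * g]. *)
Section QC3.
Variables (C3 : finGroupType) (g : C3).

Definition Q_e : P_operad C3 0 := [ffun=> 1%g].
Definition Q_tens : P_operad C3 2 := [ffun=> 1%g].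
Definition Q_box : P_operad C3 3 :=
  [ffun h => if h == 1%g then 1%g
             else if h == g then cycle123 else cycle132].

Inductive Q_generator : forall n, P_operad C3 n -> Prop :=
| Q_gen_e : Q_generator Q_e
| Q_gen_tens : Q_generator Q_tens
| Q_gen_box : Q_generator Q_box.

Definition Q_C3 : suboperad (P_operad C3) := gen_suboperad Q_generator.
End QC3.

Inductive symbol : nat -> Type :=
| sym_e : symbol 0
| sym_tens : symbol 2
| sym_box : symbol 3.

Section Presentation.
Variables (C3 : finGroupType) (g : C3).

Definition F_C3 : operad C3 := free_operad C3 symbol.

Local Notation e := (free_gen C3 sym_e : F_C3 0).
Local Notation tens := (free_gen C3 sym_tens : F_C3 2).
Local Notation box := (free_gen C3 sym_box : F_C3 3).
Local Notation one := (@op_one C3 F_C3).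

Inductive diamond : F_C3 2 -> Prop :=
| diamond_tens : diamond tens
| diamond_box1 : diamond (gamma3 box e one one)
| diamond_box2 : diamond (gamma3 box one e one)
| diamond_box3 : diamond (gamma3 box one one e).

Inductive R_C3 : forall n, F_C3 n -> F_C3 n -> Prop :=
| R_box1 : @R_C3 1 (gamma3 box one e e) one
| R_box2 : @R_C3 1 (gamma3 box e one e) one
| R_box3 : @R_C3 1 (gamma3 box e e one) one
| R_tens1 : @R_C3 1 (gamma2 tens one e) one
| R_tens2 : @R_C3 1 (gamma2 tens e one) one
| R_assoc (d : F_C3 2) :
    diamond d -> @R_C3 3 (gamma2 d d one) (gamma2 d one d)
| R_gact_box : @R_C3 3 (op_gact g box) (op_sact box cycle123)
| R_gact_tens : @R_C3 2 (op_gact g tens) tens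
| R_gact_e : @R_C3 0 (op_gact g e) e.
End Presentation.

(* Main.v *)
Require Import Defs.
From mathcomp Require Import all_boot all_order all_fingroup all_solvable.
From mathcomp Require Import boolp.

Set Implicit Arguments.
Unset Strict Implicit.
Unset Printing Implicit Defensive.

(** Modulo [R], every element of the free operad is a planar tree with nodes
[e], [tens], [box], without group labels, followed by a permutation of its
leaves.  The image of such a tree in [P_operad] amounts to three linear orders
on its leaves, indexed by the powers of [g]; the order at [1] is the planar
one, so the permutation is recovered from the image.

It remains to see that the three orders of a tree determine it modulo the unit
and associativity laws.  Let [t] and [u] have the same orders.  The children of
the root of [t] split the leaves of [u] into classes on which the orders of [u]
are constrained as if [u] had the same root, and by induction on [u] it is
equivalent to that root applied to the restrictions of [u] to these classes
(obtained by plugging [e] into the other leaves).  The induction step swaps two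
operations applied to a matrix of subtrees, rows for columns.  Since [box]
induces three different relations on its three pairs of inputs, all different
from that of [tens], so many cells of this matrix are empty that the swap
follows from the unit and associativity laws. *)

(** * Interchange of operations *)

(** In the applications the carrier holds the elements of an operad of all arities together: [tzero]
    is [e], [tone] the identity, and [tmul], [ttri] plug their arguments into [tens], [box]. With
    arities forgotten, operadic identities become equations without casts. *)
Record tops := TOps {
  tcar :> Type;
  tzero : tcar;
  tone : tcar;
  tmul : tcar -> tcar -> tcar;
  ttri : tcar -> tcar -> tcar -> tcar
}.

Record tlaws (X : tops) : Prop := TLaws {
  tmul0x : left_id (tzero X) (@tmul X);
  tmulx0 : right_id (tzero X) (@tmul X);
  tmulA : associative (@tmul X);
  ttrix00 : forall x : X, ttri x (tzero X) (tzero X) = x;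
  ttri0x0 : forall x : X, ttri (tzero X) x (tzero X) = x;
  ttri00x : forall x : X, ttri (tzero X) (tzero X) x = x;
  ttri0A : forall x y z : X,
    ttri (tzero X) x (ttri (tzero X) y z) =
    ttri (tzero X) (ttri (tzero X) x y) z;
  ttri1A : forall x y z : X,
    ttri x (tzero X) (ttri y (tzero X) z) =
    ttri (ttri x (tzero X) y) (tzero X) z;
  ttri2A : forall x y z : X,
    ttri x (ttri y z (tzero X)) (tzero X) =
    ttri (ttri x y (tzero X)) z (tzero X)
}.

(* Input [i] of [box] precedes input [j] in the order [box (g ^+ h)]. *)
Definition tri_lt h i j := (i + h) %% 3 < (j + h) %% 3.

Section Interchange.
Variables (X : tops) (HX : tlaws X).
Variables (x : nat -> nat -> X) (n : nat -> nat -> bool).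
Hypothesis n0 : forall i j, ~~ n i j -> x i j = tzero X.

(** Read [n i j] as: cell [(i, j)] contains a leaf. Leaves in cells differing in both row and column
    are compared by rows and also by columns, and the two answers must agree. *)
Definition compatible (r s : nat -> nat -> nat -> bool) k l :=
  forall i i' j j', i < k -> i' < k -> j < l -> j' < l ->
    n i j -> n i' j' -> i != i' -> j != j' -> forall h, r h i i' = s h j j'.

Local Notation m := (@tmul X).
Local Notation t := (@ttri X).

Let units :=
  (tmul0x HX, tmulx0 HX, ttrix00 HX, ttri0x0 HX, ttri00x HX).

(** Rows and columns order the cells [(0, 1)] and [(1, 0)] oppositely, so one of them is zero. *)
Lemma interchange_mul_mul :
  compatible (fun=> ltn) (fun=> ltn) 2 2 ->
  m (m (x 0 0) (x 0 1)) (m (x 1 0) (x 1 1)) =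
  m (m (x 0 0) (x 1 0)) (m (x 0 1) (x 1 1)).
Proof.
move=> H.
have E : ~~ (n 0 1 && n 1 0).
  by apply/negP => /andP[a b]; have := H 0 1 1 0 isT isT isT isT a b isT isT 0.
by case: (boolP (n 0 1)) E => [_ /n0->|/n0-> _]; rewrite !units ?(tmulA HX).
Qed.

(** The order of two inputs of [box] changes with [h], that of two inputs of [tens] does not. So
    either a column is zero or both columns live in one common row, and the unit laws suffice. *)
Lemma interchange_tri_mul :
  compatible tri_lt (fun=> ltn) 3 2 ->
  t (m (x 0 0) (x 0 1)) (m (x 1 0) (x 1 1)) (m (x 2 0) (x 2 1)) =
  m (t (x 0 0) (x 1 0) (x 2 0)) (t (x 0 1) (x 1 1) (x 2 1)).
Proof.
move=> H.
have E i i' : i < 3 -> i' < 3 -> i != i' -> ~~ (n i 0 && n i' 1).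
  move=> Hi Hi' ne; apply/negP => /andP[a b].
  have := H i i' 0 1 Hi Hi' isT isT a b ne isT; rewrite /tri_lt.
  move: i i' Hi Hi' ne {a b} => [|[|[|//]]] [|[|[|//]]] //= _ _ _ K;
  by first [have := K 0; done | have := K 1; done | have := K 2; done].
move: (E 0 1 isT isT isT) (E 0 2 isT isT isT) (E 1 0 isT isT isT)
  (E 1 2 isT isT isT) (E 2 0 isT isT isT) (E 2 1 isT isT isT).
move: (@n0 0 0) (@n0 0 1) (@n0 1 0) (@n0 1 1) (@n0 2 0) (@n0 2 1).
case: (n 0 0) (n 0 1) (n 1 0) (n 1 1) (n 2 0) (n 2 1)
  => [] [] [] [] [] [] //=;
by do 6! [move=> /(_ isT)-> | move=> _]; rewrite !units.
Qed.

(** As functions of [h], the six comparisons [tri_lt h i i'] of distinct inputs differ pairwise. So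
    two occupied cells in different rows and columns lie on the diagonal, and the support is inside
    the diagonal, a row, a column, or three cells [(i, i)], [(i, j)], [(j, j)]. *)
Lemma interchange_tri_tri :
  compatible tri_lt tri_lt 3 3 ->
  t (t (x 0 0) (x 0 1) (x 0 2)) (t (x 1 0) (x 1 1) (x 1 2))
    (t (x 2 0) (x 2 1) (x 2 2)) =
  t (t (x 0 0) (x 1 0) (x 2 0)) (t (x 0 1) (x 1 1) (x 2 1))
    (t (x 0 2) (x 1 2) (x 2 2)).
Proof.
move=> H.
have E i i' j j' : [&& i < i', i' < 3, j < 3, j' < 3, j != j' &
    (i != j) || (i' != j')] -> ~~ (n i j && n i' j').
  move=> /and5P[Hii' Hi' Hj Hj' /andP[nj nij]].
  apply/negP => /andP[a b].
  have := H i i' j j' (ltn_trans Hii' Hi') Hi' Hj Hj' a b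
    (negbT (ltn_eqF Hii')) nj.
  rewrite /tri_lt; move: i i' j j' Hii' Hi' Hj Hj' nj nij {a b}.
  move=> [|[|[|i]]] [|[|[|i']]] // [|[|[|j]]] [|[|[|j']]] //= _ _ _ _ _ _ K;
  by first [have := K 0; done | have := K 1; done | have := K 2; done].
move: (E 0 1 0 2 isT)
  (E 0 1 1 0 isT)
  (E 0 1 1 2 isT)
  (E 0 1 2 0 isT)
  (E 0 1 2 1 isT)
  (E 0 2 0 1 isT)
  (E 0 2 1 0 isT)
  (E 0 2 1 2 isT)
  (E 0 2 2 0 isT)
  (E 0 2 2 1 isT)
  (E 1 2 0 1 isT)
  (E 1 2 0 2 isT)
  (E 1 2 1 0 isT)
  (E 1 2 2 0 isT)
  (E 1 2 2 1 isT).
move: (@n0 0 0) (@n0 0 1) (@n0 0 2) (@n0 1 0) (@n0 1 1) (@n0 1 2)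
  (@n0 2 0) (@n0 2 1) (@n0 2 2).
case: (n 0 0) (n 0 1) (n 0 2) (n 1 0) (n 1 1) (n 1 2) (n 2 0) (n 2 1) (n 2 2)
  => [] [] [] [] [] [] [] [] [] //=;
do 9! [move=> /(_ isT)-> | move=> _]; rewrite !units //.
(* Associativity is needed for the three-cell supports; the unit laws settle the others. *)
all: rewrite ?(ttri0A HX, ttri1A HX, ttri2A HX) //.
Qed.
End Interchange.

(** * Labelled planar trees and their orders *)

Inductive term :=
| Var of nat
| Emp
| Mul of term & term
| Tri of term & term & term.

Fixpoint word t : seq nat :=
  match t with
  | Var i => [:: i]
  | Emp => [::]
  | Mul a b => word a ++ word b
  | Tri a b c => word a ++ word b ++ word c
  end.

Fixpoint restr (S : pred nat) t :=
  match t with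
  | Var i => if S i then Var i else Emp
  | Emp => Emp
  | Mul a b => Mul (restr S a) (restr S b)
  | Tri a b c => Tri (restr S a) (restr S b) (restr S c)
  end.

(** A label in no child counts as lying in the last one, so the bounds required by [eval_split2] and
    [eval_split3] hold for every label. *)
Definition loc2 a (p : nat) := if p \in word a then 0 else 1.
Definition loc3 a b (p : nat) :=
  if p \in word a then 0 else if p \in word b then 1 else 2.

(** [h] stands for the group element [g ^+ h]: [tens] keeps its inputs in order at every [h], while
    [box] rotates them. *)
Fixpoint ord h t p q : bool :=
  match t with
  | Mul a b =>
      if loc2 a p == loc2 a q
      then (if loc2 a p == 0 then ord h a p q else ord h b p q)
      else loc2 a p < loc2 a q
  | Tri a b c =>
      if loc3 a b p == loc3 a b q
      then (if loc3 a b p == 0 then ord h a p q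
            else if loc3 a b p == 1 then ord h b p q else ord h c p q)
      else tri_lt h (loc3 a b p) (loc3 a b q)
  | _ => false
  end.

(* [t] is an operation with arguments [us]; the label [p] of a leaf occurs in
   the [l p]-th argument, and [r h] is the [h]-th order of the arguments. *)
Record node (r : nat -> rel nat) (l : nat -> nat) t (us : seq term) : Prop :=
  Node {
  node_uniq : forall i, uniq (word (nth Emp us i));
  node_mem : forall i p,
    (p \in word (nth Emp us i)) = (p \in word t) && (l p == i);
  node_ord : forall h p q, ord h t p q =
    if l p == l q then ord h (nth Emp us (l p)) p q else r h (l p) (l q)
}.

Notation mul_lt := (fun=> ltn).

Lemma node2 a b : uniq (word (Mul a b)) ->
  node mul_lt (loc2 a) (Mul a b) [:: a; b].
Proof.
rewrite /= cat_uniq -all_predC => /and3P[ua /allP ab ub]; split.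
- by move=> [|[|i]] //=; rewrite nth_nil.
- move=> i p; rewrite /= mem_cat /loc2.
  case: i => [|[|i]] /=; rewrite ?nth_nil;
  case: (boolP (p \in word b)) => [/ab /= /negbTE->|_] //=;
  by case: (p \in word a).
- move=> h p q; rewrite /= /loc2.
  by case: (p \in word a); case: (q \in word a).
Qed.

Lemma node3 a b c : uniq (word (Tri a b c)) ->
  node tri_lt (loc3 a b) (Tri a b c) [:: a; b; c].
Proof.
rewrite /= !cat_uniq has_cat negb_or -!all_predC.
move=> /and3P[ua /andP[/allP ab /allP ac] /and3P[ub /allP bc uc]]; split.
- by move=> [|[|[|i]]] //=; rewrite nth_nil.
- move=> i p; rewrite /= !mem_cat /loc3.
  case: i => [|[|[|i]]] /=; rewrite ?nth_nil;
  case: (boolP (p \in word c)) => [pc|_] /=;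
  rewrite ?(negbTE (ac _ pc)) ?(negbTE (bc _ pc)) //=;
  case: (boolP (p \in word b)) => [/ab /= /negbTE->|_] //=;
  by case: (p \in word a).
- move=> h p q; rewrite /= /loc3.
  by case: (p \in word a); case: (q \in word a);
    case: (p \in word b); case: (q \in word b).
Qed.

(** Makes labels distinct and gives trees with equally many leaves the same word, while [eval] does
    not see labels. *)
Fixpoint relabel m t :=
  match t with
  | Var _ => Var m
  | Emp => Emp
  | Mul a b => Mul (relabel m a) (relabel (m + size (word a)) b)
  | Tri a b c =>
      Tri (relabel m a) (relabel (m + size (word a)) b)
        (relabel (m + size (word a) + size (word b)) c)
  end.

Lemma word_relabel m t : word (relabel m t) = iota m (size (word t)).
Proof.
by elim: t m => //= [a IHa b IHb|a IHa b IHb c IHc] m;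
  rewrite IHa IHb ?IHc !size_cat !iotaD.
Qed.

Lemma word_restr S t : word (restr S t) = filter S (word t).
Proof.
by elim: t => //= [i|a -> b ->|a -> b -> c ->];
  rewrite ?filter_cat//; case: ifP.
Qed.

Lemma ord_restr (S : pred nat) h t p q :
  S p -> S q -> ord h (restr S t) p q = ord h t p q.
Proof.
move=> Sp Sq; elim: t => //= [i|a IHa b IHb|a IHa b IHb c IHc].
- by case: ifP.
- by rewrite /loc2 word_restr !mem_filter Sp Sq /= IHa IHb.
- by rewrite /loc3 !word_restr !mem_filter Sp Sq /= IHa IHb IHc.
Qed.

Lemma restr_id (S : pred nat) t :
  {in word t, forall i, S i} -> restr S t = t.
Proof.
elim: t => //= [i|a IHa b IHb|a IHa b IHb c IHc] H.
- by rewrite H // mem_head.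
- by rewrite IHa ?IHb// => i Hi; apply: H; rewrite mem_cat Hi ?orbT.
- by rewrite IHa ?IHb ?IHc// => i Hi; apply: H; rewrite !mem_cat Hi ?orbT.
Qed.

(** [s] colours the leaves; different colours are compared as if they were the arguments of a root
    with orders [r]. *)
Definition respects (r : nat -> rel nat) (s : nat -> nat) t :=
  forall p q h, p \in word t -> q \in word t -> s p != s q ->
    ord h t p q = r h (s p) (s q).

Definition same_ord t u := forall p q h, p \in word t -> q \in word t ->
  ord h t p q = ord h u p q.

Section Node.
Variables (r : nat -> rel nat) (l : nat -> nat) (t : term) (us : seq term).
Hypothesis nodet : node r l t us.

Lemma node_sub i p : p \in word (nth Emp us i) -> p \in word t.
Proof. by rewrite (node_mem nodet) => /andP[]. Qed.

Lemma node_loc i p : p \in word (nth Emp us i) -> l p = i.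
Proof. by rewrite (node_mem nodet) => /andP[_ /eqP]. Qed.

Lemma node_ord_child i h p q :
  p \in word (nth Emp us i) -> q \in word (nth Emp us i) ->
  ord h t p q = ord h (nth Emp us i) p q.
Proof.
by move=> /node_loc lp /node_loc lq; rewrite (node_ord nodet) lp lq eqxx.
Qed.

Lemma node_respects r' s i : respects r' s t -> respects r' s (nth Emp us i).
Proof.
move=> H p q h pi qi; rewrite -(node_ord_child h pi qi).
by apply: H; apply: node_sub; eassumption.
Qed.

Lemma node_self : respects r l t.
Proof. by move=> p q h _ _ ne; rewrite (node_ord nodet) (negbTE ne). Qed.

Lemma node_restr u i : word t =i word u -> same_ord t u ->
  word (nth Emp us i) =i word (restr (fun p => l p == i) u) /\
  same_ord (nth Emp us i) (restr (fun p => l p == i) u).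
Proof.
move=> tu H; split=> [p|p q h pi qi].
  by rewrite word_restr mem_filter -tu (node_mem nodet) andbC.
rewrite ord_restr ?(node_loc pi) ?(node_loc qi)//.
by rewrite -H ?(node_sub pi) ?(node_sub qi)// -(node_ord_child h pi qi).
Qed.

(** Rows are the children of the root, columns the colours. Leaves from two such cells are compared
    by the root and by the colouring at once. *)
Lemma node_compatible r' s k k' : respects r' s t ->
  compatible (fun i j => has (fun p => s p == j) (word (nth Emp us i)))
    r r' k k'.
Proof.
move=> H i i' j j' _ _ _ _ /hasP[p pi /eqP pj] /hasP[q qi /eqP qj] ii jj h.
have := H p q h (node_sub pi) (node_sub qi).
rewrite pj qj (node_ord nodet) (node_loc pi) (node_loc qi) (negbTE ii).
by apply.
Qed.
End Node.

Lemma compatible_sym n r s k k' :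
  compatible n r s k k' -> compatible (fun i j => n j i) s r k' k.
Proof. by move=> H i i' j j' ? ? ? ? ? ? ? ? h; symmetry; apply: H. Qed.

(** * Evaluation of trees *)

Section Eval.
Variable X : tops.

Fixpoint eval (t : term) : X :=
  match t with
  | Var _ => tone X
  | Emp => tzero X
  | Mul a b => tmul (eval a) (eval b)
  | Tri a b c => ttri (eval a) (eval b) (eval c)
  end.

Lemma eval_relabel m t : eval (relabel m t) = eval t.
Proof.
by elim: t m => //= [a IHa b IHb|a IHa b IHb c IHc] m; rewrite IHa IHb ?IHc.
Qed.

Hypothesis HX : tlaws X.

Lemma eval_restr0 (S : pred nat) t :
  ~~ has S (word t) -> eval (restr S t) = tzero X.
Proof.
elim: t => //= [i|a IHa b IHb|a IHa b IHb c IHc].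
- by rewrite orbF => /negbTE->.
- by rewrite has_cat negb_or => /andP[/IHa-> /IHb->]; rewrite (tmul0x HX).
- rewrite !has_cat !negb_or => /and3P[/IHa-> /IHb-> /IHc->].
  by rewrite (ttrix00 HX).
Qed.

Lemma eval_word0 t : word t = [::] -> eval t = tzero X.
Proof.
move=> Ht; rewrite -(@restr_id pred0 t) ?Ht//.
by apply: eval_restr0; rewrite Ht.
Qed.

Lemma eval_word1 t i : word t = [:: i] -> eval t = tone X.
Proof.
elim: t => //= [a IHa b IHb|a IHa b IHb c IHc].
- case Ea: (word a) => [|j [|k u]] //=.
    by rewrite (eval_word0 Ea) (tmul0x HX).
  by case=> ji; rewrite IHa ?Ea ?ji// => /eval_word0->; rewrite (tmulx0 HX).
- case Ea: (word a) => [|j [|k u]] //=.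
    rewrite (eval_word0 Ea).
    case Eb: (word b) => [|j [|k u]] //=.
      by rewrite (eval_word0 Eb) (ttri00x HX).
    by case=> ji; rewrite IHb ?Eb ?ji// => /eval_word0->; rewrite (ttri0x0 HX).
  case=> ji; rewrite IHa ?Ea ?ji//.
  case Eb: (word b) => //= /eval_word0->.
  by rewrite (eval_word0 Eb) (ttrix00 HX).
Qed.

(** Induction splits each child by colour, giving a matrix with the children as rows. Since [restr]
    works child by child, its columns are the restrictions of the whole tree, and interchange
    applies. *)
Lemma eval_split2 (s : nat -> nat) t : uniq (word t) ->
  respects mul_lt s t -> (forall p, s p < 2) ->
  eval t = tmul (eval (restr (fun p => s p == 0) t))
                (eval (restr (fun p => s p == 1) t)).
Proof.
move=> + + Hs; elim: t => [i _ _|_ _|a IHa b IHb|a IHa b IHb c IHc] /=.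
- by case: (s i) (Hs i) => [|[|//]] _ /=; rewrite ?(tmul0x HX) ?(tmulx0 HX).
- by rewrite (tmul0x HX).
- move=> /node2 N H.
  rewrite (IHa (node_uniq N 0) (node_respects N (i := 0) H)).
  rewrite (IHb (node_uniq N 1) (node_respects N (i := 1) H)).
  pose x i j := eval (restr (fun p => s p == j) (nth Emp [:: a; b] i)).
  apply: (@interchange_mul_mul X HX x _ _ (node_compatible N H)).
  by move=> i j /eval_restr0.
- move=> /node3 N H.
  rewrite (IHa (node_uniq N 0) (node_respects N (i := 0) H)).
  rewrite (IHb (node_uniq N 1) (node_respects N (i := 1) H)).
  rewrite (IHc (node_uniq N 2) (node_respects N (i := 2) H)).
  pose x i j := eval (restr (fun p => s p == j) (nth Emp [:: a; b; c] i)).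
  apply: (@interchange_tri_mul X HX x _ _ (node_compatible N H)).
  by move=> i j /eval_restr0.
Qed.

Lemma eval_split3 (s : nat -> nat) t : uniq (word t) ->
  respects tri_lt s t -> (forall p, s p < 3) ->
  eval t = ttri (eval (restr (fun p => s p == 0) t))
                (eval (restr (fun p => s p == 1) t))
                (eval (restr (fun p => s p == 2) t)).
Proof.
move=> + + Hs; elim: t => [i _ _|_ _|a IHa b IHb|a IHa b IHb c IHc] /=.
- case: (s i) (Hs i) => [|[|[|//]]] _ /=;
  by rewrite ?(ttrix00 HX) ?(ttri0x0 HX) ?(ttri00x HX).
- by rewrite (ttrix00 HX).
- move=> /node2 N H.
  rewrite (IHa (node_uniq N 0) (node_respects N (i := 0) H)).
  rewrite (IHb (node_uniq N 1) (node_respects N (i := 1) H)).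
  (* The three colours index the rows here, so the matrix is transposed and interchange is read
     backwards. *)
  pose x j i := eval (restr (fun p => s p == j) (nth Emp [:: a; b] i)).
  symmetry; apply: (@interchange_tri_mul X HX x _ _
    (compatible_sym (node_compatible N H))).
  by move=> i j /eval_restr0.
- move=> /node3 N H.
  rewrite (IHa (node_uniq N 0) (node_respects N (i := 0) H)).
  rewrite (IHb (node_uniq N 1) (node_respects N (i := 1) H)).
  rewrite (IHc (node_uniq N 2) (node_respects N (i := 2) H)).
  pose x i j := eval (restr (fun p => s p == j) (nth Emp [:: a; b; c] i)).
  apply: (@interchange_tri_tri X HX x _ _ (node_compatible N H)).
  by move=> i j /eval_restr0.
Qed.

(** Induction on [t] alone: [u] is split along the children of the root of [t], and each child is
    compared with a restriction of [u]. *)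
Theorem eval_ord t u : uniq (word t) -> uniq (word u) -> word t =i word u ->
  same_ord t u -> eval t = eval u.
Proof.
elim: t u => [i||a IHa b IHb|a IHa b IHb c IHc] u U.
- move=> Uu tu _; apply/esym/(@eval_word1 _ i)/perm_small_eq => //.
  by rewrite uniq_perm// => p; rewrite -tu.
- move=> _ tu _; apply/esym/eval_word0.
  by case: (word u) tu => // p s /(_ p); rewrite mem_head.
- move=> Uu tu H; have N := node2 U.
  rewrite (@eval_split2 (loc2 a) u) //; last 2 first.
  + move=> p q h; rewrite -!tu => Hp Hq ne.
    by rewrite -H // (node_self N).
  + by move=> p; rewrite /loc2; case: ifP.
  have [W0 S0] := node_restr N 0 tu H; have [W1 S1] := node_restr N 1 tu H.
  congr tmul; [apply: IHa W0 S0|apply: IHb W1 S1];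
  first [exact: (node_uniq N 0)|exact: (node_uniq N 1)|
      rewrite word_restr filter_uniq //].
- move=> Uu tu H; have N := node3 U.
  rewrite (@eval_split3 (loc3 a b) u) //; last 2 first.
  + move=> p q h; rewrite -!tu => Hp Hq ne.
    by rewrite -H // (node_self N).
  + by move=> p; rewrite /loc3; case: ifP => //; case: ifP.
  have [W0 S0] := node_restr N 0 tu H; have [W1 S1] := node_restr N 1 tu H.
  have [W2 S2] := node_restr N 2 tu H.
  congr ttri; [apply: IHa W0 S0|apply: IHb W1 S1|apply: IHc W2 S2];
  first [exact: (node_uniq N 0)|exact: (node_uniq N 1)|
    exact: (node_uniq N 2)|rewrite word_restr filter_uniq //].
Qed.
End Eval.

(** * Composition in an operad, up to arity *)

Section Comp.
Variables (gT : finGroupType) (O : operad gT).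
Local Notation elt := {k & O k}.
Local Notation one := (Tagged O (@op_one _ O)).

(* The inputs of [u] beyond the length of [s] receive the identity. *)
Definition opcomp (u : elt) (s : seq elt) : elt :=
  Tagged O (op_gamma (tagged u) (fun i => tagged (nth one s i))).

Lemma opcomp_fam n (x : O n) (k : 'I_n -> nat) (y : forall i, O (k i)) s :
  (forall i, Tagged O (y i) = nth one s i) ->
  Tagged O (op_gamma x y) = opcomp (Tagged O x) s.
Proof.
(* A family of pairs of an arity and an element is a non-dependent function, so [funext] applies. *)
pose f (ys : 'I_n -> elt) := Tagged O (op_gamma x (fun i => tagged (ys i))).
move=> H; have := congr1 f (funext H); exact.
Qed.

Lemma opcomp_ext (u : elt) s s' :
  (forall i, i < tag u -> nth one s i = nth one s' i) ->
  opcomp u s = opcomp u s'.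
Proof.
move=> H; rewrite [LHS](@opcomp_fam _ _ _ _ s') => [|i]; first by case: u H.
by rewrite -H //; case: nth.
Qed.

Lemma opcomp_one s : opcomp one s = nth one s 0.
Proof. by rewrite /opcomp -(tag_castn (sum_ord1 _)) op_gamma1l; case: nth. Qed.

Lemma opcomp_nseq n (x : O n) : opcomp (Tagged O x) (nseq n one) = Tagged O x.
Proof.
rewrite -[in RHS](op_gamma1r x) tag_castn.
rewrite [RHS](@opcomp_fam _ _ _ _ (nseq n one)) // => i.
by rewrite nth_nseq ltn_ord.
Qed.

Lemma opcomp_zero (x : O 0) s : opcomp (Tagged O x) s = Tagged O x.
Proof. by rewrite -[RHS]opcomp_nseq; apply: opcomp_ext. Qed.

Lemma Rank_sumn n (ys : seq elt) (i : 'I_n) (j : 'I_(tag (nth one ys i))) :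
  size ys = n ->
  @tagnat.Rank n (fun i => tag (nth one ys i)) i j =
  sumn (take i [seq tag y | y <- ys]) + j :> nat.
Proof.
move=> sz; rewrite [LHS]tagnat.RankEsum; congr (_ + _).
rewrite sumnE (big_nth 0) size_takel ?size_map ?sz 1?ltnW//.
rewrite big_mkord (big_ord_widen _ _ (ltnW (ltn_ord i))).
apply: eq_bigr => l li; rewrite nth_take// (nth_map one)//.
by rewrite sz.
Qed.

(** [w i] starts at the first input of block [i] and is not cut at its end, since [opcomp] ignores
    entries beyond the arity. *)
Lemma opcompA u ys zs (w := fun i => drop (sumn (take i (map tag ys))) zs) :
  size ys = tag u ->
  opcomp (opcomp u ys) zs =
  opcomp u [seq opcomp (nth one ys i) (w i) | i <- iota 0 (tag u)].
Proof.
move=> sz; rewrite [LHS]/opcomp -(tag_castn (sum_Rank _)) op_gammaA.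
rewrite [LHS](@opcomp_fam _ _ _ _
  [seq opcomp (nth one ys i) (w i) | i <- iota 0 (tag u)]).
  by case: u sz.
move=> i; rewrite (nth_map 0) ?size_iota// nth_iota// add0n.
rewrite [LHS](@opcomp_fam _ _ _ _ (w i)); first by case: nth.
move=> j; rewrite nth_drop.
by rewrite Rank_sumn//; case: nth.
Qed.

Lemma gamma2E (x : O 2) k1 k2 (y1 : O k1) (y2 : O k2) :
  Tagged O (gamma2 x y1 y2) =
  opcomp (Tagged O x) [:: Tagged O y1; Tagged O y2].
Proof.
rewrite /gamma2 tag_castn; apply: opcomp_fam => i.
by rewrite (tnth_nth one); case: nth.
Qed.

Lemma gamma3E (x : O 3) k1 k2 k3 (y1 : O k1) (y2 : O k2) (y3 : O k3) :
  Tagged O (gamma3 x y1 y2 y3) =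
  opcomp (Tagged O x) [:: Tagged O y1; Tagged O y2; Tagged O y3].
Proof.
rewrite /gamma3 tag_castn; apply: opcomp_fam => i.
by rewrite (tnth_nth one); case: nth.
Qed.

(** * Unit and associativity laws in an operad *)

Variables (e : O 0) (tens : O 2) (box : O 3).
Local Notation zero := (Tagged O e).

Definition etri (x y z : elt) := opcomp (Tagged O box) [:: x; y; z].

Definition op_tops : tops :=
  @TOps elt zero one (fun y z => opcomp (Tagged O tens) [:: y; z]) etri.

Lemma opcomp_box1 s : opcomp (etri zero one one) s =
  etri zero (nth one s 0) (nth one s 1).
Proof. by rewrite opcompA //= !opcomp_one opcomp_zero /= !nth_drop. Qed.

Lemma opcomp_box2 s : opcomp (etri one zero one) s =
  etri (nth one s 0) zero (nth one s 1).
Proof. by rewrite opcompA //= !opcomp_one opcomp_zero /= !nth_drop. Qed.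

Lemma opcomp_box3 s : opcomp (etri one one zero) s =
  etri (nth one s 0) (nth one s 1) zero.
Proof. by rewrite opcompA //= !opcomp_one opcomp_zero /= !nth_drop. Qed.

Definition assoc (d : O 2) :=
  @gamma2 _ O d 2 1 d op_one = @gamma2 _ O d 1 2 op_one d.

(** Writing [d] as its composite with identities turns both sides, for [tens], into values of trees
    with leaves [one]. *)
Lemma assoc_elt (d : O 2) (u := Tagged O d) (v := opcomp u [:: one; one]) :
  opcomp u [:: v; one] = opcomp u [:: one; v] -> assoc d.
Proof.
rewrite /v (opcomp_nseq d : opcomp u [:: one; one] = u) => E.
apply: tagI; apply: etrans (gamma2E d d op_one) _.
exact: etrans E (esym (gamma2E d op_one d)).
Qed.

Lemma assoc_box1_elt (v := etri zero one one) :
  etri zero v one = etri zero one v ->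
  assoc (@gamma3 _ O box 0 1 1 e op_one op_one).
Proof.
move=> H; apply: assoc_elt; rewrite (opcomp_nseq (n := 2)).
have -> : Tagged O (gamma3 box e op_one op_one : O 2) = v.
  exact: (gamma3E box e op_one op_one).
by rewrite !opcomp_box1.
Qed.

Lemma assoc_box2_elt (v := etri one zero one) :
  etri v zero one = etri one zero v ->
  assoc (@gamma3 _ O box 1 0 1 op_one e op_one).
Proof.
move=> H; apply: assoc_elt; rewrite (opcomp_nseq (n := 2)).
have -> : Tagged O (gamma3 box op_one e op_one : O 2) = v.
  exact: (gamma3E box op_one e op_one).
by rewrite !opcomp_box2.
Qed.

Lemma assoc_box3_elt (v := etri one one zero) :
  etri v one zero = etri one v zero ->
  assoc (@gamma3 _ O box 1 1 0 op_one op_one e).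
Proof.
move=> H; apply: assoc_elt; rewrite (opcomp_nseq (n := 2)).
have -> : Tagged O (gamma3 box op_one op_one e : O 2) = v.
  exact: (gamma3E box op_one op_one e).
by rewrite !opcomp_box3.
Qed.

Lemma opcomp_assoc (d : O 2) : assoc d ->
  forall x y z, opcomp (Tagged O d) [:: opcomp (Tagged O d) [:: x; y]; z] =
  opcomp (Tagged O d) [:: x; opcomp (Tagged O d) [:: y; z]].
Proof.
move=> /(congr1 (fun u : O 3 => opcomp (Tagged O u) _)) H x y z.
have : opcomp (Tagged O (gamma2 d d op_one)) [:: x; y; z] =
  opcomp (Tagged O (gamma2 d op_one d)) [:: x; y; z] := H _.
rewrite !gamma2E !opcompA //= !opcomp_one /= => E.
(* After [opcompA] the inner list still carries the surplus entry [z], which the binary [d]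
   ignores. *)
transitivity (opcomp (Tagged O d) [:: opcomp (Tagged O d) [:: x; y; z]; z]).
  by congr opcomp; congr cons; apply: opcomp_ext => -[|[|]].
by rewrite E.
Qed.

Hypotheses
  (unit_box1 : @gamma3 _ O box 1 0 0 op_one e e = op_one :> O 1)
  (unit_box2 : @gamma3 _ O box 0 1 0 e op_one e = op_one :> O 1)
  (unit_box3 : @gamma3 _ O box 0 0 1 e e op_one = op_one :> O 1)
  (unit_tens1 : @gamma2 _ O tens 1 0 op_one e = op_one :> O 1)
  (unit_tens2 : @gamma2 _ O tens 0 1 e op_one = op_one :> O 1).
Hypotheses (assoc_tens : assoc tens)
  (assoc_box1 : assoc (@gamma3 _ O box 0 1 1 e op_one op_one))
  (assoc_box2 : assoc (@gamma3 _ O box 1 0 1 op_one e op_one))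
  (assoc_box3 : assoc (@gamma3 _ O box 1 1 0 op_one op_one e)).

Lemma op_tlaws : tlaws op_tops.
Proof.
have C (u v x : elt) : u = v -> opcomp u [:: x] = opcomp v [:: x] by move->.
have b1 : etri one zero zero = one.
  by rewrite /etri -gamma3E; exact: (congr1 (Tagged O) unit_box1).
have b2 : etri zero one zero = one.
  by rewrite /etri -gamma3E; exact: (congr1 (Tagged O) unit_box2).
have b3 : etri zero zero one = one.
  by rewrite /etri -gamma3E; exact: (congr1 (Tagged O) unit_box3).
have t1 : opcomp (Tagged O tens) [:: one; zero] = one.
  by rewrite -gamma2E; exact: (congr1 (Tagged O) unit_tens1).
have t2 : opcomp (Tagged O tens) [:: zero; one] = one.
  by rewrite -gamma2E; exact: (congr1 (Tagged O) unit_tens2).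
split=> /=.
- by move=> x; move: (C _ _ x t2); rewrite opcompA //= !opcomp_one opcomp_zero.
- by move=> x; move: (C _ _ x t1); rewrite opcompA //= !opcomp_one opcomp_zero.
- by move=> x y z; rewrite opcomp_assoc.
- by move=> x; move: (C _ _ x b1); rewrite opcompA //= !opcomp_one !opcomp_zero.
- by move=> x; move: (C _ _ x b2); rewrite opcompA //= !opcomp_one !opcomp_zero.
- by move=> x; move: (C _ _ x b3); rewrite opcompA //= !opcomp_one !opcomp_zero.
- move=> x y z; have := opcomp_assoc assoc_box1 x y z.
  have -> : Tagged O (gamma3 box e op_one op_one : O 2) = etri zero one one.
    exact: (gamma3E box e op_one op_one).
  by rewrite !opcomp_box1.
- move=> x y z; have := opcomp_assoc assoc_box2 x y z.
  have -> : Tagged O (gamma3 box op_one e op_one : O 2) = etri one zero one.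
    exact: (gamma3E box op_one e op_one).
  by rewrite !opcomp_box2.
- move=> x y z; have := opcomp_assoc assoc_box3 x y z.
  have -> : Tagged O (gamma3 box op_one op_one e : O 2) = etri one one zero.
    exact: (gamma3E box op_one op_one e).
  by rewrite !opcomp_box3.
Qed.
End Comp.

Section Hom.
Variables (gT : finGroupType) (O O' : operad gT) (f : operad_hom O O').

Definition hom_elt (u : {k & O k}) : {k & O' k} := Tagged O' (f _ (tagged u)).

Lemma hom_comp u s :
  hom_elt (opcomp u s) = opcomp (hom_elt u) (map hom_elt s).
Proof.
rewrite /hom_elt /opcomp /= op_hom_gamma; apply: opcomp_fam => i.
elim: s (nat_of_ord i) => [|y s IH] [|j] //=; rewrite ?op_hom_one//.
Qed.

Lemma hom_eval e tens box t :
  hom_elt (eval (op_tops e tens box) t) =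
  eval (op_tops (f _ e) (f _ tens) (f _ box)) t.
Proof.
elim: t => [i||a IHa b IHb|a IHa b IHb c IHc] //=.
- by rewrite /hom_elt /= op_hom_one.
- by rewrite hom_comp /= IHa IHb.
- by rewrite /etri hom_comp /= IHa IHb IHc.
Qed.

Lemma hom_gamma2 x k1 k2 (y1 : O k1) (y2 : O k2) :
  f _ (gamma2 x y1 y2) = gamma2 (f _ x) (f _ y1) (f _ y2).
Proof.
apply: tagI; rewrite -[LHS]/(hom_elt (Tagged O _)) !gamma2E hom_comp //.
Qed.

Lemma hom_gamma3 x k1 k2 k3 (y1 : O k1) (y2 : O k2) (y3 : O k3) :
  f _ (gamma3 x y1 y2 y3) = gamma3 (f _ x) (f _ y1) (f _ y2) (f _ y3).
Proof.
apply: tagI; rewrite -[LHS]/(hom_elt (Tagged O _)) !gamma3E hom_comp //.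
Qed.
End Hom.

(** * The three orders of an element of P *)

(** The value at [p] is the number of [q] with a smaller value. *)
Lemma perm_lt_inj n (s t : 'S_n) :
  (forall p q, (s p < s q) = (t p < t q)) -> s = t.
Proof.
have val_perm (u : 'S_n) p : \sum_(q | u q < u p) 1 = u p.
  rewrite (reindex_perm u^-1) /=; under eq_bigl do rewrite permKV.
  by rewrite -(big_ord_widen _ (fun=> 1)) ?sum_const1// ltnW.
move=> H; apply/permP => p; apply: val_inj.
rewrite /= -[LHS]val_perm -[RHS]val_perm.
by apply: eq_bigl => q; rewrite H.
Qed.

Lemma perm_gamma11 n (k : 'I_n -> nat) :
  perm_gamma 1 (fun i => 1 : 'S_(k i))%g = 1%g.
Proof.
apply: perm_lt_inj => p q; have [i [j ->]] := RankP p.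
by have [i' [j' ->]] := RankP q; rewrite perm_gamma_lt !perm1 ltn_Rank.
Qed.

Lemma nth_flatten_sumn (T : Type) (x : T) ss i j :
  i < size ss -> j < size (nth [::] ss i) ->
  nth x (flatten ss) (sumn (take i (shape ss)) + j) = nth x (nth [::] ss i) j.
Proof.
elim: ss i => [|s ss IH] [|i] //= Hi Hj; rewrite nth_cat ?Hj//.
by rewrite -addnA ltnNge leq_addr /= addKn IH.
Qed.

Section PC3.
Variables (C3 : finGroupType) (g : C3).
Local Notation P := (P_operad C3).
Local Notation elt := {k & P k}.
Local Notation one := (Tagged P (@op_one _ P)).

Definition PT := op_tops (Q_e C3) (Q_tens C3) (Q_box g).

(** The [p]-th input of [y] is matched with the [p]-th leaf of [t]; the element [h] will be
    [g ^+ k]. *)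
Definition represents h k (y : elt) t :=
  tag y = size (word t) /\ forall p q : 'I_(tag y),
    (tagged y h p < tagged y h q) =
    ord k t (nth 0 (word t) p) (nth 0 (word t) q).

(** A composite permutation compares two inputs by their blocks, and within one block by the inner
    permutation, which is the recursion defining [ord]. *)
Lemma represents_comp h k r l (u : elt) ys t us :
  size us = tag u -> size ys = tag u -> word t = flatten (map word us) ->
  node r l t us ->
  (forall i, i < tag u -> represents h k (nth one ys i) (nth Emp us i)) ->
  (forall i j, (tagged u h i < tagged u h j) = r k i j) ->
  represents h k (opcomp u ys) t.
Proof.
move=> su sy wt N H Hu.
have sh : [seq tag y | y <- ys] = shape (map word us).
  rewrite /shape -map_comp.
  apply: (@eq_from_nth _ 0); rewrite !size_map sy ?su// => i Hi.
  by rewrite (nth_map one) ?sy// (nth_map Emp) ?su//; have [] := H i Hi.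
split; first by rewrite wt size_flatten -sh sumnE big_map (big_nth one)
    big_mkord sy.
have nthR (i : 'I_(tag u)) (j : 'I_(tag (nth one ys i))) :
    nth 0 (word t) (@tagnat.Rank _ (fun i => tag (nth one ys i)) i j) =
    nth 0 (word (nth Emp us i)) j.
  rewrite Rank_sumn// sh wt nth_flatten_sumn ?size_map ?su//
    (nth_map Emp) ?su//.
  by have [<-] := H i (ltn_ord i).
move=> p q; have [i [j ->]] := RankP p; have [i' [j' ->]] := RankP q.
have mem (a : 'I_(tag u)) (b : 'I_(tag (nth one ys a))) :
    nth 0 (word (nth Emp us a)) b \in word (nth Emp us a).
  by apply: mem_nth; have [<-] := H a (ltn_ord a).
rewrite !nthR (node_ord N) !(node_loc N (mem _ _)).
rewrite ffunE perm_gamma_lt val_eqE.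
have [E|ne] := eqVneq i i'; last by rewrite orbF Hu.
by case: i' / E j' => j' /=; rewrite ltnn /=; have [_ ->] := H i (ltn_ord i).
Qed.

Lemma tens_lt h (i j : 'I_2) : (Q_tens C3 h i < Q_tens C3 h j) = (i < j).
Proof. by rewrite ffunE !perm1. Qed.

Hypotheses (g3 : (g ^+ 3)%g = 1%g) (g1 : g != 1%g).
Hypothesis genC3 : forall h, exists2 k, k < 3 & h = (g ^+ k)%g.

(** The first three powers of [g] are distinct, so each selects its own case of [Q_box]; [cycle132]
    adds two modulo three. *)
Lemma Q_boxE k (i : 'I_3) : Q_box g (g ^+ k)%g i = (i + k) %% 3 :> nat.
Proof.
have g21 : (g ^+ 2)%g != 1%g.
  by apply: contra g1 => /eqP g2; rewrite -g3 expgS g2 mulg1.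
have g2g : (g ^+ 2)%g != g.
  apply: contra g1 => /eqP g2; apply/eqP/(mulgI g).
  by rewrite mulg1 -[RHS]g2 expgS expg1.
have gk : (g ^+ k)%g = (g ^+ (k %% 3))%g.
  by rewrite {1}(divn_eq k 3) mulnC expgD expgM g3 expg1n mul1g.
rewrite gk -modnDmr ffunE.
 case: (k %% 3) (ltn_pmod k (isT : 0 < 3)) => [|[|[|//]]] _.
- by rewrite expg0 eqxx perm1 addn0 modn_small.
- by rewrite expg1 (negbTE g1) eqxx permE /= addn1.
- by rewrite (negbTE g21) (negbTE g2g) permE /= addnS.
Qed.

Lemma box_lt k (i j : 'I_3) :
  (Q_box g (g ^+ k)%g i < Q_box g (g ^+ k)%g j) = tri_lt k i j.
Proof. by rewrite !Q_boxE. Qed.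

Lemma represents_eval k t : k < 3 -> uniq (word t) ->
  represents (g ^+ k)%g k (eval PT t) t.
Proof.
move=> k3; elim: t => [i||a IHa b IHb|a IHa b IHb c IHc] U.
- by split=> // p q; rewrite /= !ord1 ltnn.
- by split=> // -[].
- have N := node2 U; apply: (represents_comp _ _ _ N) => //= [|i|].
  + by rewrite cats0.
  + by case: i => [|[|//]] _ /=;
      [apply: IHa (node_uniq N 0)|apply: IHb (node_uniq N 1)].
  + exact: tens_lt.
- have N := node3 U; apply: (represents_comp _ _ _ N) => //= [|i|i j].
  + by rewrite cats0.
  + by case: i => [|[|[|//]]] _ /=; [apply: IHa (node_uniq N 0)
      |apply: IHb (node_uniq N 1)|apply: IHc (node_uniq N 2)].
  + exact: box_lt.
Qed.

Lemma tri_lt_mod h i j : tri_lt h i j = tri_lt (h %% 3) i j.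
Proof. by rewrite /tri_lt !modnDmr. Qed.

(** Needed because [same_ord] ranges over all natural [h], while [represents_eval] covers exponents
    below three. *)
Lemma ord_mod h t p q : ord h t p q = ord (h %% 3) t p q.
Proof.
elim: t => //= [a -> b ->|a -> b -> c ->] //; by rewrite -tri_lt_mod.
Qed.

(** The orders fix every comparison of values, hence each permutation. This verifies the
    associativity relations in [P_operad]. *)
Lemma eval_P_inj t u : uniq (word t) -> word t = word u -> same_ord t u ->
  eval PT t = eval PT u.
Proof.
move=> Ut tu H; have Uu : uniq (word u) by rewrite -tu.
have := fun k (k3 : k < 3) => represents_eval k3 Uu.
have := fun k (k3 : k < 3) => represents_eval k3 Ut.
case: (eval PT t) (eval PT u) => [n x] [m y] Rx Ry.
have [/= nt _] := Rx 0 isT; have [/= mu _] := Ry 0 isT.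
have nm : n = m by rewrite nt mu tu.
case: m / nm y mu Ry => y _ Ry; congr Tagged; apply/ffunP => h.
have [k k3 ->] := genC3 h; apply: perm_lt_inj => p q.
have [_ /= ->] := Rx k k3; have [_ /= ->] := Ry k k3.
by rewrite -tu H // mem_nth -?nt.
Qed.

Lemma same_ord_eval_P t u : uniq (word t) -> word t = word u ->
  eval PT t = eval PT u -> same_ord t u.
Proof.
move=> Ut tu E p q h pt qt; have Uu : uniq (word u) by rewrite -tu.
rewrite (ord_mod _ t) (ord_mod _ u).
have k3 := ltn_pmod h (isT : 0 < 3); move: (h %% 3) k3 => k k3.
have [st Ht] := represents_eval k3 Ut; have [su Hu] := represents_eval k3 Uu.
rewrite E in st Ht.
have ip : index p (word t) < tag (eval PT u) by rewrite st index_mem.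
have iq : index q (word t) < tag (eval PT u) by rewrite st index_mem.
have := Ht (Ordinal ip) (Ordinal iq); rewrite Hu /= -tu !nth_index//.
Qed.

Lemma P_gamma1 n (k : 'I_n -> nat) (x : P n) (y : forall i, P (k i)) :
  x 1%g = 1%g -> (forall i, y i 1%g = 1%g) -> @op_gamma _ P n k x y 1%g = 1%g.
Proof.
move=> Hx Hy; rewrite ffunE Hx -[RHS](perm_gamma11 k).
exact: perm_gamma_ext.
Qed.

(** The generators are primitive, and primitive elements are closed under composition. This lets
    [toP_inj] read off the leaf permutation at the unit. *)
Lemma eval_P1 t : tagged (eval PT t) 1%g = 1%g.
Proof.
have P1 (u : elt) s : tagged u 1%g = 1%g ->
    (forall i, i < tag u -> tagged (nth one s i) 1%g = 1%g) ->
    tagged (opcomp u s) 1%g = 1%g.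
  case: u => n x Hx Hs; apply: (P_gamma1 (x := x)) => // i.
  exact: Hs.
elim: t => [i||a IHa b IHb|a IHa b IHb c IHc].
- by rewrite ffunE.
- by rewrite ffunE.
- by apply: P1 => [|[|[|]]] //; rewrite ffunE.
- by apply: P1 => [|[|[|[|]]]] //; rewrite ffunE eqxx.
Qed.

Lemma P1_eq (x y : P 1) : x = y.
Proof. by apply/ffunP => h; apply/permP => i; rewrite !ord1. Qed.

(** In each use both bracketings compare two leaves through the same inputs, so the last hypothesis
    holds by computation with [h] a variable. *)
Lemma eval_P_assoc t u : word t = [:: 0; 1; 2] -> word u = [:: 0; 1; 2] ->
  (forall p q h, p < 3 -> q < 3 -> ord h t p q = ord h u p q) ->
  eval PT t = eval PT u.
Proof.
move=> wt wu H; apply: eval_P_inj; rewrite ?wt// => p q h.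
by rewrite wt => Hp Hq; apply: H; [move: Hp|move: Hq];
  rewrite !inE => /or3P[]/eqP->.
Qed.

Lemma P_assoc_tens : assoc (Q_tens C3).
Proof.
apply: assoc_elt; apply: (@eval_P_assoc (Mul (Mul (Var 0) (Var 1)) (Var 2))
  (Mul (Var 0) (Mul (Var 1) (Var 2)))) => //.
by move=> [|[|[|//]]] [|[|[|//]]].
Qed.

Lemma P_assoc_box1 :
  assoc (@gamma3 _ P (Q_box g) 0 1 1 (Q_e C3) op_one op_one).
Proof.
apply: assoc_box1_elt; apply: (@eval_P_assoc
  (Tri Emp (Tri Emp (Var 0) (Var 1)) (Var 2))
  (Tri Emp (Var 0) (Tri Emp (Var 1) (Var 2)))) => //.
by move=> [|[|[|//]]] [|[|[|//]]].
Qed.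

Lemma P_assoc_box2 :
  assoc (@gamma3 _ P (Q_box g) 1 0 1 op_one (Q_e C3) op_one).
Proof.
apply: assoc_box2_elt; apply: (@eval_P_assoc
  (Tri (Tri (Var 0) Emp (Var 1)) Emp (Var 2))
  (Tri (Var 0) Emp (Tri (Var 1) Emp (Var 2)))) => //.
by move=> [|[|[|//]]] [|[|[|//]]].
Qed.

Lemma P_assoc_box3 :
  assoc (@gamma3 _ P (Q_box g) 1 1 0 op_one op_one (Q_e C3)).
Proof.
apply: assoc_box3_elt; apply: (@eval_P_assoc
  (Tri (Tri (Var 0) (Var 1) Emp) (Var 2) Emp)
  (Tri (Var 0) (Tri (Var 1) (Var 2) Emp) Emp)) => //.
by move=> [|[|[|//]]] [|[|[|//]]].
Qed.

(** At [g ^+ k] the left side is [Q_box] at [g ^+ k.+1], a rotation by one followed by a rotation by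
    [k]. *)
Lemma P_gact_box : op_gact g (Q_box g : P 3) = op_sact (Q_box g : P 3) cycle123.
Proof.
apply/ffunP => h; have [k _ ->] := genC3 h.
apply/permP => i; apply: val_inj; rewrite [in LHS]ffunE [in RHS]ffunE pmulE.
by rewrite -expgSr /= !Q_boxE permE /= modnDml addnS.
Qed.

Lemma P_gact_tens h : op_gact h (Q_tens C3 : P 2) = Q_tens C3.
Proof. by apply/ffunP => k; rewrite !ffunE. Qed.

Lemma P_gact_e h : op_gact h (Q_e C3 : P 0) = Q_e C3.
Proof. by apply/ffunP => k; rewrite !ffunE. Qed.
End PC3.

(** * The isomorphism *)

Lemma bij_operad_iso (gT : finGroupType) (O O' : operad gT)
    (f : operad_hom O O') :
  (forall n, injective (f n)) -> (forall n y, exists x, f n x = y) ->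
  operad_iso O O'.
Proof.
move=> finj fsurj; pose G n y := sval (cid (fsurj n y)).
have GK n : cancel (G n) (f n) by move=> y; apply: (svalP (cid (fsurj n y))).
have H : exists f' : operad_hom O' O, forall n, @op_hom_fun _ _ _ f' n = G n.
  unshelve eexists (@OperadHom _ O' O G _ _ _ _) => //.
  - by move=> h n x; apply: finj; rewrite op_hom_gact !GK.
  - by move=> n x s; apply: finj; rewrite op_hom_sact !GK.
  - by apply: finj; rewrite op_hom_one GK.
  - move=> n k x y; apply: finj; rewrite op_hom_gamma !GK.
    congr op_gamma; apply: functional_extensionality_dep => i.
    by rewrite GK.
have [f' Ef'] := H; exists f, f'.
by split=> n x; rewrite Ef' ?GK//; apply: finj; rewrite GK.
Qed.

(** * First isomorphism theorem for operads *)

Section FirstIso.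
Variables (gT : finGroupType) (O O' : operad gT) (f : operad_hom O O').
Variables (C : congruence O) (Q : suboperad O').

Definition quot_hom : operad_hom O (quotient_operad C).
Proof.
refine (@OperadHom gT O (quotient_operad C) (@quot_pi gT O C) _ _ _ _) => //.
- by move=> h n x; rewrite /= quot_gact_pi.
- by move=> n x s; rewrite /= quot_sact_pi.
- by move=> n k x y; rewrite /= quot_gamma_pi.
Defined.

Hypothesis Cf : forall n (x y : O n), C n x y -> f n x = f n y.

Lemma quot_repr_hom n (x : O n) : f n (quot_repr (quot_pi C x)) = f n x.
Proof. exact/Cf/quot_repr_pi. Qed.

Definition quot_lift : operad_hom (quotient_operad C) O'.
Proof.
refine (@OperadHom gT (quotient_operad C) O'
  (fun n x => f n (@quot_repr gT O C n x)) _ _ _ _).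
- by move=> h n x; rewrite /= quot_repr_hom op_hom_gact.
- by move=> n x s; rewrite /= quot_repr_hom op_hom_sact.
- by rewrite /= quot_repr_hom op_hom_one.
- by move=> n k x y; rewrite /= quot_repr_hom op_hom_gamma.
Defined.

Hypothesis fC : forall n (x y : O n), f n x = f n y -> C n x y.
Hypothesis Qf : forall n (x : O n), Q n (f n x).
Hypothesis fQ : forall n (y : O' n), Q n y -> exists x, f n x = y.

Definition quot_colift : operad_hom (quotient_operad C) (suboperad_operad Q).
Proof.
refine (@OperadHom _ (quotient_operad C) (suboperad_operad Q)
  (fun n x => exist _ (quot_lift n x) (Qf (quot_repr x))) _ _ _ _).
- by move=> h n x; apply: sub_val_inj; apply: (op_hom_gact quot_lift).
- by move=> n x s; apply: sub_val_inj; apply: (op_hom_sact quot_lift).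
- by apply: sub_val_inj; apply: (op_hom_one quot_lift).
- by move=> n k x y; apply: sub_val_inj; apply: (op_hom_gamma quot_lift).
Defined.

Lemma first_iso : operad_iso (quotient_operad C) (suboperad_operad Q).
Proof.
apply: (bij_operad_iso (f := quot_colift)) => [n x y /(congr1 sval) /= /fC|n].
  by move=> /quot_piP; rewrite !quot_reprK.
case=> y Qy; have [x fx] := fQ Qy.
by exists (quot_pi C x); apply: sub_val_inj; rewrite /= quot_repr_hom.
Qed.
End FirstIso.

(** Contains the generated congruence once it contains the relations. *)
Definition ker_congruence (gT : finGroupType) (O O' : operad gT)
  (f : operad_hom O O') : congruence O.
Proof.
refine (@Congruence _ O (fun n x y => f n x = f n y) _ _ _ _ _ _) => //.
- by move=> n x y z -> ->.
- by move=> h n x y E; rewrite !op_hom_gact E.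
- by move=> n x y s E; rewrite !op_hom_sact E.
- move=> n k x x' y y' E E'; rewrite !op_hom_gamma E; congr op_gamma.
  exact: functional_extensionality_dep.
Defined.

(** Contains [Q_C3] once it contains the three generators, which gives surjectivity. *)
Definition image_suboperad (gT : finGroupType) (O O' : operad gT)
  (f : operad_hom O O') : suboperad O'.
Proof.
refine (@SubOperad _ O' (fun n y => exists x, f n x = y) _ _ _ _).
- by move=> h n _ [x <-]; exists (op_gact h x); rewrite op_hom_gact.
- by move=> n _ s [x <-]; exists (op_sact x s); rewrite op_hom_sact.
- by exists op_one; rewrite op_hom_one.
- move=> n k _ y [x <-] Hy; exists (op_gamma x (fun i => sval (cid (Hy i)))).
  rewrite op_hom_gamma; congr op_gamma.
  by apply: functional_extensionality_dep => i; apply: (svalP (cid (Hy i))).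
Defined.

(** * The map from the free operad to [P_operad] *)

Section Presentation.
Variables (C3 : finGroupType) (g : C3).
Local Notation P := (P_operad C3).

Definition sym_P n (s : symbol n) : P n :=
  match s in symbol n return P n with
  | sym_e => Q_e C3
  | sym_tens => Q_tens C3
  | sym_box => Q_box g
  end.

Lemma free_hom_gen (gT : finGroupType) (S : nat -> Type) (O : operad gT)
    (phi : forall n, S n -> O n) n (s : S n) :
  free_hom phi n (free_gen gT s) = phi n s.
Proof.
by rewrite /= op_sact1 (castn_map (tree_eval phi)) /= op_gamma1r op_gact1.
Qed.

Local Notation F := (F_C3 C3).
Local Notation e := (free_gen C3 sym_e : F 0).
Local Notation tens := (free_gen C3 sym_tens : F 2).
Local Notation box := (free_gen C3 sym_box : F 3).

Definition toP : operad_hom F P := free_hom sym_P.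

Lemma toP_gen n (s : symbol n) : toP n (free_gen C3 s : F n) = sym_P s.
Proof. exact: free_hom_gen. Qed.

Hypotheses (g3 : (g ^+ 3)%g = 1%g) (g1 : g != 1%g).
Hypothesis genC3 : forall h, exists2 k, k < 3 & h = (g ^+ k)%g.

Lemma toP_R n (x y : F_C3 C3 n) : R_C3 g x y -> toP n x = toP n y.
Proof.
case: n x y /.
(* The five unit relations hold because [P 1] is a single point. *)
- exact: P1_eq.
- exact: P1_eq.
- exact: P1_eq.
- exact: P1_eq.
- exact: P1_eq.
- move=> d dd.
  apply: etrans (hom_gamma2 toP d d op_one) _.
  apply: etrans _ (esym (hom_gamma2 toP d op_one d)).
  rewrite op_hom_one; suff : assoc (toP 2 d) by [].
  case: d / dd.
  + by rewrite toP_gen; apply: P_assoc_tens genC3.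
  + have -> : toP 2 (gamma3 box e op_one op_one : F 2) =
        gamma3 (Q_box g) (Q_e C3) op_one op_one :> P 2.
      apply: etrans (hom_gamma3 toP box e op_one op_one) _.
      by rewrite op_hom_one !toP_gen.
    exact: P_assoc_box1.
  + have -> : toP 2 (gamma3 box op_one e op_one : F 2) =
        gamma3 (Q_box g) op_one (Q_e C3) op_one :> P 2.
      apply: etrans (hom_gamma3 toP box op_one e op_one) _.
      by rewrite op_hom_one !toP_gen.
    exact: P_assoc_box2.
  + have -> : toP 2 (gamma3 box op_one op_one e : F 2) =
        gamma3 (Q_box g) op_one op_one (Q_e C3) :> P 2.
      apply: etrans (hom_gamma3 toP box op_one op_one e) _.
      by rewrite op_hom_one !toP_gen.
    exact: P_assoc_box3.
- rewrite op_hom_gact op_hom_sact toP_gen; exact: P_gact_box.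
- rewrite op_hom_gact toP_gen; exact: P_gact_tens.
- rewrite op_hom_gact toP_gen; exact: P_gact_e.
Qed.

(** * Normal forms in the quotient, and injectivity *)

Local Notation C := (gen_congruence (R_C3 g)).
Local Notation QO := (quotient_operad C).
Local Notation pi := (quot_hom C).
Local Notation one := (@op_one _ F).

Lemma pi_R n (x y : F n) : R_C3 g x y -> pi n x = pi n y.
Proof. by move=> Rxy; apply/quot_piP => D; apply. Qed.

Definition QT := op_tops (pi 0 e) (pi 2 tens) (pi 3 box).

Lemma QT_laws : tlaws QT.
Proof.
have A d : diamond d -> assoc (pi 2 d).
  move=> dd; apply: etrans (esym (hom_gamma2 pi d d one)) _.
  apply: etrans (hom_gamma2 pi d one d).
  exact: (pi_R (R_assoc g dd)).
apply: op_tlaws.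
- by rewrite -(op_hom_one pi) -(hom_gamma3 pi) (pi_R (R_box1 g)).
- by rewrite -(op_hom_one pi) -(hom_gamma3 pi) (pi_R (R_box2 g)).
- by rewrite -(op_hom_one pi) -(hom_gamma3 pi) (pi_R (R_box3 g)).
- by rewrite -(op_hom_one pi) -(hom_gamma2 pi) (pi_R (R_tens1 g)).
- by rewrite -(op_hom_one pi) -(hom_gamma2 pi) (pi_R (R_tens2 g)).
- exact: A (diamond_tens _).
- by have := A _ (diamond_box1 _); rewrite -(op_hom_one pi) -(hom_gamma3 pi).
- by have := A _ (diamond_box2 _); rewrite -(op_hom_one pi) -(hom_gamma3 pi).
- by have := A _ (diamond_box3 _); rewrite -(op_hom_one pi) -(hom_gamma3 pi).
Qed.

Definition planar n (z : QO n) := exists t, Tagged QO z = eval QT t.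

Definition rep n (z : QO n) :=
  exists s : 'S_n, exists2 x : QO n, planar x & z = op_sact x s.

Lemma rep_sact n (z : QO n) s : rep z -> rep (op_sact z s).
Proof.
move=> [r [x Px ->]]; exists (pmul r s), x => //.
by rewrite op_sactM.
Qed.

(** The induction step of [repP] at a node with operation [u]. *)
Definition gamma_closed n (u : QO n) :=
  forall (k : 'I_n -> nat) (y : forall i, QO (k i)),
  (forall i, rep (y i)) -> rep (op_gamma u y).

Lemma gamma_closed_sact n (u : QO n) s :
  gamma_closed u -> gamma_closed (op_sact u s).
Proof.
move=> cu k y Hy; rewrite op_gamma_block; apply: rep_sact.
have : rep (op_gamma u (fun i => y ((s^-1)%g i))) by apply: cu.
by case: _ / (sum_perm k s).
Qed.

(** The permutations of the arguments leave the composite as a block sum, so only planar arguments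
    remain. *)
Lemma gamma_closed_planar n (u : QO n) :
  (forall ts, size ts = n ->
     exists t, opcomp (Tagged QO u) (map (eval QT) ts) = eval QT t) ->
  gamma_closed u.
Proof.
move=> cu k y Hy.
pose r i := sval (cid (Hy i)).
have Hr i : exists2 x, planar x & y i = op_sact x (r i) := svalP (cid (Hy i)).
pose x i := s2val (cid2 (Hr i)).
have Ey i : y i = op_sact (x i) (r i) := s2valP' (cid2 (Hr i)).
pose t i := sval (cid (s2valP (cid2 (Hr i)))).
have Ht i : Tagged QO (x i) = eval QT (t i) :=
  svalP (cid (s2valP (cid2 (Hr i)))).
have -> : y = fun i => op_sact (x i) (r i).
  exact: functional_extensionality_dep.
rewrite op_gamma_sum; exists (block_sum r), (op_gamma u x) => //.
have [t' Et'] := cu [seq t i | i <- enum 'I_n]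
  (etrans (size_map _ _) (size_enum_ord n)).
exists t'; rewrite -Et'; apply: opcomp_fam => i.
rewrite -map_comp (nth_map i) ?size_enum_ord// nth_ord_enum.
exact: Ht.
Qed.

Lemma gamma_closed_gen n (s : symbol n) :
  gamma_closed (pi n (free_gen C3 s : F n)).
Proof.
apply: gamma_closed_planar; case: n / s => -[|a [|b [|c []]]] // _.
- by exists Emp; apply: opcomp_zero.
- by exists (Mul a b).
- by exists (Tri a b c).
Qed.

(** Trades group labels for leaf permutations: the relations do so for [g], and since the two
    actions commute this extends to its powers. *)
Lemma gact_gen n (s : symbol n) h : exists r : 'S_n,
  op_gact h (pi n (free_gen C3 s : F n)) =
  op_sact (pi n (free_gen C3 s : F n)) r.
Proof.
have [r Hr] : exists r : 'S_n,
    op_gact g (pi n (free_gen C3 s : F n)) =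
    op_sact (pi n (free_gen C3 s : F n)) r.
  case: n / s.
  - by exists 1%g; rewrite op_sact1 -(op_hom_gact pi) (pi_R (R_gact_e g)).
  - by exists 1%g; rewrite op_sact1 -(op_hom_gact pi) (pi_R (R_gact_tens g)).
  - exists cycle123.
    by rewrite -(op_hom_gact pi) (pi_R (R_gact_box g)) op_hom_sact.
have [k _ ->] := genC3 h; elim: k => [|k [r' IH]].
  by exists 1%g; rewrite op_gact1 op_sact1.
exists (pmul r' r).
by rewrite expgSr op_gactM Hr op_gact_sact IH -op_sactM.
Qed.

Lemma repP n (z : QO n) : rep z.
Proof.
elim/quot_ind: z => x; change (rep (pi n x)).
pose phi m (s : symbol m) : QO m := pi m (free_gen C3 s : F m).
have [f [_ Hf]] := free_operad_universal phi.
(* By uniqueness in the universal property, [pi] evaluates trees in the quotient, so induction on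
   the tree applies. *)
have -> : pi n x = free_hom phi n x.
  rewrite (Hf (free_hom phi)) ?(Hf pi)// => m s; exact: free_hom_gen.
case: x => t s; apply: rep_sact.
change (rep (tree_eval phi t)); elim: t {s} => [|k [h s] a ts IH].
  exists 1%g, op_one; last by rewrite op_sact1.
  by exists (Var 0).
have [r Hr] : exists r, op_gact h (phi k s) = op_sact (phi k s) r.
  exact: gact_gen.
change (rep (op_gamma (op_gact h (phi k s)) (fun i => tree_eval phi (ts i)))).
rewrite Hr.
exact/gamma_closed_sact/IH/gamma_closed_gen.
Qed.

Lemma toP_C n (x y : F n) : C n x y -> toP n x = toP n y.
Proof. by move=> Cxy; apply: (Cxy (ker_congruence toP)) => m u v /toP_R. Qed.

Local Notation lift := (quot_lift toP_C).

Lemma lift_pi n (x : F n) : lift n (pi n x) = toP n x.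
Proof. exact: quot_repr_hom toP_C _ _. Qed.

Lemma lift_planar n (x : QO n) t : Tagged QO x = eval QT t ->
  Tagged P (lift n x) = eval (PT g) t.
Proof.
move=> Ex; rewrite -[LHS]/(hom_elt lift (Tagged QO x)) Ex hom_eval.
by rewrite !lift_pi !toP_gen.
Qed.

Lemma toP_inj n (x y : F n) : toP n x = toP n y -> C n x y.
Proof.
move=> E; apply/quot_piP; change (pi n x = pi n y).
move: E; rewrite -!lift_pi.
have [r [x' [t Ex] ->]] := repP (pi n x).
have [r' [y' [u Ey] ->]] := repP (pi n y).
rewrite !op_hom_sact => E.
have lt := lift_planar Ex; have lu := lift_planar Ey.
have x1 : lift n x' 1%g = 1%g.
  by have := eval_P1 g t; rewrite -lt.
have y1 : lift n y' 1%g = 1%g.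
  by have := eval_P1 g u; rewrite -lu.
(* The planar parts are primitive, so the values at the unit are the two leaf permutations, which
   therefore agree. *)
have sact1 (z : P n) (q : 'S_n) : z 1%g = 1%g -> op_sact z q 1%g = q.
  by rewrite ffunE => ->; rewrite /pmul mulg1.
have rr : r = r'.
  apply: etrans (esym (sact1 _ r x1)) _.
  exact: etrans (congr1 (fun f : P n => f 1%g) E) (sact1 _ r' y1).
rewrite -rr in E *; congr op_sact.
have Exy : lift n x' = lift n y'.
  rewrite -[LHS]op_sact1 -[RHS]op_sact1 -(mulVg r).
  by rewrite -[(_ * _)%g]/(pmul r r^-1) !op_sactM E.
have Etu : eval (PT g) t = eval (PT g) u by rewrite -lt -lu Exy.
(* Equal arities force equally many leaves; [represents_eval] wants distinct labels, hence the
   relabelling. *)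
have size_w v : size (word v) = tag (eval (PT g) v).
  rewrite -(eval_relabel _ 0) -(size_iota 0 (size (word v))) -word_relabel.
  have U : uniq (word (relabel 0 v)) by rewrite word_relabel iota_uniq.
  by have [] := represents_eval g3 g1 (isT : 0 < 3) U.
apply: tagI; rewrite Ex Ey -(eval_relabel _ 0 t) -(eval_relabel _ 0 u).
have Ut : uniq (word (relabel 0 t)) by rewrite word_relabel iota_uniq.
have W : word (relabel 0 t) = word (relabel 0 u).
  by rewrite !word_relabel !size_w Etu.
apply: (eval_ord QT_laws) => //; rewrite -?W//.
apply: (same_ord_eval_P g3 g1) => //.
by rewrite !eval_relabel.
Qed.

Lemma toP_Q n (x : F n) : Q_C3 g n (toP n x).
Proof.
case: x => t s; apply: sub_sact.
change (Q_C3 g _ (tree_eval sym_P t)); elim: t {s} => [|k [h s] a ts IH].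
  exact: (sub_one (Q_C3 g)).
apply: sub_gamma => //; apply: sub_gact => Q; apply.
by case: k / s {a ts IH}; constructor.
Qed.

Lemma presentation_iso : operad_iso QO (suboperad_operad (Q_C3 g)).
Proof.
apply: (first_iso (f := toP)) => [n x y|n x y|n x|n y Qy].
- exact: toP_C.
- exact: toP_inj.
- exact: toP_Q.
- apply: (Qy (image_suboperad toP)) => m u; case: m u /.
  + by exists e; rewrite toP_gen.
  + by exists tens; rewrite toP_gen.
  + by exists box; rewrite toP_gen.
Qed.
End Presentation.

Theorem theorem3p10 (C3 : finGroupType) (g : C3)
    (cardC3 : #|[set: C3]| = 3) (genC3 : generator [set: C3] g) :
  operad_iso (quotient_operad (gen_congruence (R_C3 g)))
             (suboperad_operad (Q_C3 g)).
Proof.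
have og : #[g]%g = 3 by rewrite /order -(eqP genC3).
apply: presentation_iso.
- by rewrite -og expg_order.
- by apply/eqP => g1; move: og; rewrite g1 order1.
- move=> h; have : h \in <[g]>%g by rewrite -(eqP genC3) inE.
  by case/cyclePmin => k; rewrite og => k3 ->; exists k.
Qed.
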